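(* Let $\mathrm A$ be a subalgebra of the quantum upper cluster algebra (given by subalgebras $\mathrm A(t)\subset\mathcal U_q(t)$, $t\in\Delta^+$, identified with each other via $\mathrm A(t')=\mu^*_{t,t'}\mathrm A(t)$), where the seeds are injective-reachable. If $\mathrm A$ possesses the common triangular basis $\mathbf L$, then $\mathbf L$ is permuted by any twist automorphism, i.e. for every $t\in\Delta^+$ and every twist automorphism $\mathrm{tw}$ on $\mathcal F(t)$, $\mathrm{tw}$ restricts to a permutation of the realization of $\mathbf L$ in $\mathcal{LP}(t)$.
   Context: **Quantum seeds.** $\Bbbk=\mathbb Z[q^{\pm1/2}]$, $v=q^{1/2}$, $\mathbf m=v^{-1}\mathbb Z[v^{-1}]$, $[x]_+=\max(x,0)$ (componentwise for vectors), $\mathbb N=\{0,1,\dots\}$. $I=I_{uf}\sqcup I_f$ is a finite set (unfrozen/frozen vertices). A quantum seed $t$ consists of an integer matrix $\tilde B(t)=(b_{ij})_{i\in I,j\in I_{uf}}$ of full rank $|I_{uf}|$ whose square part $B(t)=(b_{ij})_{i,j\in I_{uf}}$ is skew-symmetrizable, a skew-symmetric integer matrix $\Lambda(t)=(\Lambda_{ij})_{i,j\in I}$ with $\tilde B(t)^T\Lambda(t)=(D'\ 0)$, $D'=\mathrm{diag}(d'_k)_{k\in I_{uf}}$, $d'_k\in\mathbb Z_{>0}$, and variables $X_i(t)$, $i\in I$. $M^\circ(t)=\bigoplus_{i\in I}\mathbb Zf_i\cong\mathbb Z^I$ carries $\lambda(f_i,f_j)=\Lambda_{ij}$. $\mathcal{LP}(t)=\bigoplus_{m\in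 M^\circ(t)}\Bbbk X(t)^m$ has commutative product $X^m\cdot X^{m'}=X^{m+m'}$ and twisted product $X^m*X^{m'}=v^{\lambda(m,m')}X^{m+m'}$; $X_i(t)=X(t)^{f_i}$; as an algebra it is taken with $*$, and $\mathcal F(t)$ is its skew-field of fractions. $Y(t)^n=X(t)^{\tilde B(t)n}$ for $n\in\mathbb Z^{I_{uf}}$, and $Y_k(t)=Y(t)^{e_k}$. $\mathcal P=\{X(t)^u:u\in\mathbb Z^{I_f}\}$ is the group of frozen factors (frozen variables are the same in all seeds). The bar involution is the $\mathbb Z$-linear anti-automorphism with $v\mapsto v^{-1}$, $X(t)^m\mapsto X(t)^m$. For $k\in I_{uf}$, $t'=\mu_kt$ has $b'_{ij}=-b_{ij}$ if $k\in\{i,j\}$, otherwise $b'_{ij}=b_{ij}+b_{ik}[b_{kj}]_++[-b_{ik}]_+b_{kj}$; $\Lambda(t')_{ij}=\lambda(f'_i,f'_j)$ with $f'_i=f_i$ ($i\ne k$), $f'_k=-f_k+\sum_j[-b_{jk}]_+f_j$; and $\mu_k^*:\mathcal F(t')\cong\mathcal F(t)$ sends $X_i(t')\mapsto X_i(t)$ ($i\ne k$), $X_k(t')\mapsto X(t)^{-f_k+\sum_j[-b_{jk}]_+f_j}+X(t)^{-f_k+\sum_j[b_{jk}]_+f_j}$. $\Delta^+$ is the set of seeds obtained from an initial seed by iterated mutations. A mutation sequence $\overleftarrow\mu$ with $t_2=\overleftarrow\mu t_1$ induces the composite $\overleftarrow\mu^*:\mathcal F(t_2)\cong\mathcal F(t_1)$,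 which depends only on $t_1,t_2$ and is also written $\mu^*_{t_2,t_1}$. $\mathcal U_q(t)=\bigcap_{t'\in\Delta^+}\mu^*_{t',t}\mathcal{LP}(t')$. Quantum cluster monomials of a seed $s$ are the $\mu^*_{s,t}X(s)^m$, $m\in\mathbb N^I$. **Degrees.** $m'\preceq_tm$ in $M^\circ(t)$ iff $m'=m+\tilde B(t)n$ for some $n\in\mathbb N^{I_{uf}}$. An element is $g$-pointed (pointed at $g$, of degree $g$) if it has the form $X(t)^g\cdot(1+\sum_{0\ne n\in\mathbb N^{I_{uf}}}c_nY(t)^n)$, $c_n\in\Bbbk$. If $Z$ has a unique $\prec_t$-maximal Laurent degree, $[Z]^t$ denotes $Z$ divided by the coefficient at that degree. **Tropical transformations, compatibility.** For $t'=\mu_kt$, $\phi_{t',t}:M^\circ(t)\to M^\circ(t')$, $g\mapsto g'$, is $g'_k=-g_k$, $g'_i=g_i+[b_{ik}]_+g_k$ if $i\neq k,g_k\ge0$, $g'_i=g_i+[-b_{ik}]_+g_k$ if $i\ne k,g_k<0$; for general $t'\in\Delta^+$, $\phi_{t',t}$ is the composite along a mutation sequence from $t$ to $t'$ (independent of the choice). Pointed sets $\{S_g\}\subset\mathcal{LP}(t)$ and $\{S'_{g'}\}\subset\mathcal{LP}(t')$ are compatible if $\mu^*_{t,t'}S_g=S'_{\phi_{t',t}g}$ for all $g$. **Injective-reachability.** $t$ is injective-reachable if there are $t[1]=\overleftarrow\mu t\in\Delta^+$ and a permutation $\sigma$ of $I_{uf}$ such that for each $k\in I_{uf}$ the $I_{uf}$-part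 of the degree of $\overleftarrow\mu^*X_{\sigma k}(t[1])\in\mathcal{LP}(t)$ is $-f_k$; the property then holds for all seeds of $\Delta^+$. **Triangular bases.** A $\Bbbk$-basis $\mathbf L$ of $\mathrm A(t)$ is the triangular basis for $t$ if: (1) its elements are bar-invariant; (2) it contains the quantum cluster monomials of $t$ and $t[1]$; (3) $\mathbf L=\{\mathbf L_g\mid g\in M^\circ(t)\}$ with $\mathbf L_g$ $g$-pointed; (4) for all $i\in I$, $g$: $[X_i(t)*\mathbf L_g]^t=\mathbf L_{g+f_i}+\sum_{g'\prec_tg+f_i}b_{g'}\mathbf L_{g'}$, $b_{g'}\in\mathbf m$. It is the common triangular basis if $\mu^*_{t,t'}\mathbf L$ is the triangular basis of $\mathrm A(t')=\mu^*_{t,t'}\mathrm A(t)$ for every $t'\in\Delta^+$ and these bases are pairwise compatible. **Twist automorphisms.** Seeds $t,t'$ are similar up to a permutation $\sigma$ of $I_{uf}$ if $b_{\sigma i,\sigma j}(t')=b_{ij}(t)$ for $i,j\in I_{uf}$ and $d'_{\sigma k}(t')=d'_k(t)$. For such $t'=\overleftarrow\mu t\in\Delta^+$, a variation map is an algebra isomorphism $\mathrm{var}^t:\mathcal F(t)\cong\mathcal F(t')$ (for $*$) such that $\mathrm{var}^t(X_k(t))=p_k\cdot X_{\sigma k}(t')$ with $p_k\in\mathcal P$ and $\mathrm{var}^t(Y_k(t))=Y_{\sigma k}(t')$ for $k\in I_{uf}$, and $\mathrm{var}^t(\mathcal P)=\mathcal P$. The composite $\mathrm{tw}=\overleftarrow\mu^*\mathrm{var}^t:\mathcal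 F(t)\cong\mathcal F(t)$ is a (cluster) twist automorphism (passing through $t'$). *)

(* Defs.v *)
From HB Require Import structures.
From mathcomp Require Import all_boot all_order all_algebra all_fingroup.
From mathcomp Require Import finmap ring lra monalg.
From mathcomp Require Import boolp classical_sets functions.

Set Implicit Arguments.
Unset Strict Implicit.
Unset Printing Implicit Defensive.

Import Order.TTheory GRing.Theory Num.Theory.
Local Open Scope ring_scope.

(* Convolution of finitely supported functions on an abelian group, twisted by
   a weight c: the bilinear product with  x^a * x^b = c(a,b) x^(a+b). *)
Section TwistedConvolution.
Context (K : zmodType) (R : comNzRingType) (c : K -> K -> R).
Implicit Types f g h : {malg R[K]}.

Definition tconv f g : {malg R[K]} :=
  \sum_(a <- msupp f) \sum_(b <- msupp g) << c a b * (f@_a * g@_b) *g a + b >>.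

Lemma tconvEw (d1 d2 : {fset K}) f g :
  (msupp f `<=` d1)%fset -> (msupp g `<=` d2)%fset ->
  tconv f g = \sum_(a <- d1) \sum_(b <- d2) << c a b * (f@_a * g@_b) *g a + b >>.
Proof.
move=> le1 le2; rewrite /tconv (big_fset_incl _ le1) /=; last first.
  move=> a _ /mcoeff_outdom fa0; rewrite big1 // => b _.
  by rewrite fa0 mul0r mulr0 monalgU0.
apply: eq_bigr => a _; rewrite (big_fset_incl _ le2) //= => b _ /mcoeff_outdom gb0.
by rewrite gb0 !mulr0 monalgU0.
Qed.

Lemma tconvDl : left_distributive tconv +%R.
Proof.
move=> f g h.
have H := fsubsetUl (msupp f) (msupp g); have H' := fsubsetUr (msupp f) (msupp g).
rewrite (tconvEw (msuppD_le f g) (fsubset_refl _)) (tconvEw H (fsubset_refl _)).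
rewrite (tconvEw H' (fsubset_refl _)) -big_split /=; apply: eq_bigr => a _.
rewrite -big_split /=; apply: eq_bigr => b _.
by rewrite mcoeffD mulrDl mulrDr monalgUD.
Qed.

Lemma tconvDr : right_distributive tconv +%R.
Proof.
move=> h f g.
have H := fsubsetUl (msupp f) (msupp g); have H' := fsubsetUr (msupp f) (msupp g).
rewrite (tconvEw (fsubset_refl _) (msuppD_le f g)) (tconvEw (fsubset_refl _) H).
rewrite (tconvEw (fsubset_refl _) H') -big_split /=; apply: eq_bigr => a _.
rewrite -big_split /=; apply: eq_bigr => b _.
by rewrite mcoeffD !mulrDr monalgUD.
Qed.

Lemma tconv0g f : tconv 0 f = 0.
Proof. by rewrite /tconv msupp0 big_seq_fset0. Qed.

Lemma tconvg0 f : tconv f 0 = 0.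
Proof. by rewrite /tconv big1 // => a _; rewrite msupp0 big_seq_fset0. Qed.

Lemma tconvUU x y a b : tconv << x *g a >> << y *g b >> = << c a b * (x * y) *g a + b >>.
Proof.
by rewrite (tconvEw msuppU_le msuppU_le) !big_seq_fset1 !mcoeffUU.
Qed.

Lemma tconv_suml (I : Type) (r : seq I) (P : pred I) (E : I -> {malg R[K]}) g :
  tconv (\sum_(i <- r | P i) E i) g = \sum_(i <- r | P i) tconv (E i) g.
Proof. by apply: (big_morph (tconv^~ g)) => [x y|]; rewrite ?tconvDl ?tconv0g. Qed.

Lemma tconv_sumr (I : Type) (r : seq I) (P : pred I) (E : I -> {malg R[K]}) f :
  tconv f (\sum_(i <- r | P i) E i) = \sum_(i <- r | P i) tconv f (E i).
Proof. by apply: (big_morph (tconv f)) => [x y|]; rewrite ?tconvDr ?tconvg0. Qed.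

Lemma tconvZl x f g : tconv (x *: f) g = x *: tconv f g.
Proof.
rewrite (tconvEw (msuppZ_le x f) (fsubset_refl _)) /tconv scaler_sumr.
apply: eq_bigr => a _; rewrite scaler_sumr; apply: eq_bigr => b _.
apply/malgP => k; rewrite !(mcoeffZ, mcoeffU).
by case: (_ == _); rewrite /= ?mulr1n ?mulr0n ?mulr0 //; ring.
Qed.

Lemma tconvZr x f g : tconv f (x *: g) = x *: tconv f g.
Proof.
rewrite (tconvEw (fsubset_refl _) (msuppZ_le x g)) /tconv scaler_sumr.
apply: eq_bigr => a _; rewrite scaler_sumr; apply: eq_bigr => b _.
apply/malgP => k; rewrite !(mcoeffZ, mcoeffU).
by case: (_ == _); rewrite /= ?mulr1n ?mulr0n ?mulr0 //; ring.
Qed.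

Hypothesis c_cocycle :
  forall a b d, c a b * c (a + b) d = c b d * c a (b + d).
Hypothesis c0l : forall a, c 0 a = 1.
Hypothesis c0r : forall a, c a 0 = 1.

Lemma tconvA : associative tconv.
Proof.
move=> f g h; rewrite (monalgE f) !tconv_suml; apply: eq_bigr => a _.
rewrite (monalgE g) !(tconv_suml, tconv_sumr); apply: eq_bigr => b _.
rewrite (monalgE h) !(tconv_suml, tconv_sumr); apply: eq_bigr => d _.
rewrite !tconvUU addrA; congr mkmalgU.
transitivity (c b d * c a (b + d) * (f@_a * g@_b * h@_d)); first by ring.
by rewrite -c_cocycle; ring.
Qed.

Lemma tconv1g : left_id << 1 *g 0 >> tconv.
Proof.
move=> f; rewrite {1}(monalgE f) tconv_sumr [RHS]monalgE.
by apply: eq_bigr => a _; rewrite tconvUU c0l !mul1r add0r.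
Qed.

Lemma tconvg1 : right_id << 1 *g 0 >> tconv.
Proof.
move=> f; rewrite {1}(monalgE f) tconv_suml [RHS]monalgE.
by apply: eq_bigr => a _; rewrite tconvUU c0r mul1r mulr1 addr0.
Qed.

Lemma tconvC : (forall a b, c a b = c b a) -> commutative tconv.
Proof.
move=> cC f g; rewrite /tconv exchange_big; apply: eq_bigr => a _.
by apply: eq_bigr => b _; rewrite cC (mulrC f@__) addrC.
Qed.

Lemma malgU1_neq0 (a : K) : << (1 : R) *g a >> != 0.
Proof. by rewrite monalgU_eq0 oner_neq0. Qed.

End TwistedConvolution.

(* The ring Z[v, v^-1]; the coefficient c@_n is that of v^n. *)
Definition kk : Type := {malg int[int]}.
HB.instance Definition _ := GRing.Zmodule.on kk.

Section Kk.
Let c1 (_ _ : int) : int := 1.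
Let kk_mulA : associative (tconv c1).
Proof. exact: tconvA. Qed.
Let kk_mulC : commutative (tconv c1).
Proof. exact: tconvC. Qed.
Let kk_mul1 : left_id << 1 *g 0 >> (tconv c1).
Proof. exact: tconv1g. Qed.
Let kk_neq0 : << 1 *g 0 >> != 0 :> kk.
Proof. exact: malgU1_neq0. Qed.
HB.instance Definition _ := GRing.Zmodule_isComNzRing.Build kk
  kk_mulA kk_mulC kk_mul1 (tconvDl c1) kk_neq0.
End Kk.

Definition vpow (n : int) : kk := << 1 *g n >>.

Lemma vpowD m n : vpow (m + n) = vpow m * vpow n.
Proof. by rewrite /vpow [RHS]tconvUU !mulr1. Qed.

Lemma vpow0 : vpow 0 = 1. Proof. by []. Qed.

Definition kk_bar (c : kk) : kk := \sum_(n <- msupp c) << c@_n *g - n >>.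

(* the non-unital subring m = v^-1 Z[v^-1] *)
Definition in_m (c : kk) : Prop := forall n : int, 0 <= n -> c@_n = 0.

(* Z^T and its standard basis *)
Notation "''Z^' T" := {ffun T -> int} (at level 8, T at level 2, format "''Z^' T").

Definition fvec (T : finType) (i : T) : 'Z^T := [ffun j => (i == j)%:R].

Definition bilin (T : finType) (Lam : T -> T -> int) (m m' : 'Z^T) : int :=
  \sum_i \sum_j m i * m' j * Lam i j.

Section Bilin.
Context (T : finType) (Lam : T -> T -> int).

Lemma bilinDl m n p : bilin Lam (m + n) p = bilin Lam m p + bilin Lam n p.
Proof.
rewrite /bilin -big_split; apply: eq_bigr => i _; rewrite -big_split.
by apply: eq_bigr => j _; rewrite ffunE /= !mulrDl.
Qed.

Lemma bilinDr m n p : bilin Lam p (m + n) = bilin Lam p m + bilin Lam p n.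
Proof.
rewrite /bilin -big_split; apply: eq_bigr => i _; rewrite -big_split.
by apply: eq_bigr => j _; rewrite ffunE /= mulrDr mulrDl.
Qed.

Lemma bilin0l p : bilin Lam 0 p = 0.
Proof. by apply: (addrI (bilin Lam 0 p)); rewrite -bilinDl !addr0. Qed.

Lemma bilin0r p : bilin Lam p 0 = 0.
Proof. by apply: (addrI (bilin Lam p 0)); rewrite -bilinDr !addr0. Qed.

Lemma bilinNl m p : bilin Lam (- m) p = - bilin Lam m p.
Proof. by apply: (addrI (bilin Lam m p)); rewrite -bilinDl !subrr bilin0l. Qed.

Lemma bilinNr m p : bilin Lam p (- m) = - bilin Lam p m.
Proof. by apply: (addrI (bilin Lam p m)); rewrite -bilinDr !subrr bilin0r. Qed.

Lemma bilinff i j : bilin Lam (fvec i) (fvec j) = Lam i j.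
Proof.
rewrite /bilin (bigD1 i) //= (bigD1 j) //= !ffunE !eqxx !mul1r !big1 ?addr0 //.
- by move=> i' /negPf ni; apply: big1 => j' _; rewrite ffunE eq_sym ni !mul0r.
- by move=> j' /negPf nj; rewrite !ffunE (eq_sym j) nj mulr0 mul0r.
Qed.

End Bilin.

(* The quantum torus of an integer matrix Lam: the free kk-module on the X^m,
   m in Z^T, whose ring product is the twisted one,
   X^m * X^m' = v^(Lam(m,m')) X^(m+m'). *)
Definition qtorus (T : finType) (Lam : T -> T -> int) : Type := {malg kk['Z^T]}.

Section QTorus.
Context (T : finType) (Lam : T -> T -> int).
Let c (m m' : 'Z^T) : kk := vpow (bilin Lam m m').

Let c_cocycle a b d : c a b * c (a + b) d = c b d * c a (b + d).
Proof. by rewrite /c -!vpowD bilinDl bilinDr; congr vpow; ring. Qed.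
Let c0l a : c 0 a = 1. Proof. by rewrite /c bilin0l. Qed.
Let c0r a : c a 0 = 1. Proof. by rewrite /c bilin0r. Qed.

HB.instance Definition _ := GRing.Lmodule.copy (qtorus Lam) {malg kk['Z^T]}.
HB.instance Definition _ := GRing.Zmodule_isNzRing.Build (qtorus Lam)
  (tconvA c_cocycle) (tconv1g c0l) (tconvg1 c0r) (tconvDl c) (tconvDr c)
  (malgU1_neq0 kk (0 : 'Z^T)).
Let scaleAl (x : kk) (f g : qtorus Lam) : x *: (f * g) = x *: f * g.
Proof. by rewrite [RHS]tconvZl. Qed.
HB.instance Definition _ :=
  GRing.Lmodule_isLalgebra.Build kk (qtorus Lam) scaleAl.
Let scaleAr (x : kk) (f g : qtorus Lam) : x *: (f * g) = f * (x *: g).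
Proof. by rewrite [RHS]tconvZr. Qed.
HB.instance Definition _ :=
  GRing.Lalgebra_isAlgebra.Build kk (qtorus Lam) scaleAr.

Definition Xpow (m : 'Z^T) : qtorus Lam := << 1 *g m >>.

(* the commutative product X^m . X^m' = X^(m+m') *)
Definition cmul (f g : qtorus Lam) : qtorus Lam := tconv (fun _ _ => 1) f g.

Definition bar (f : qtorus Lam) : qtorus Lam :=
  \sum_(m <- msupp f) << kk_bar f@_m *g m >>.

Lemma XpowM m m' : Xpow m * Xpow m' = vpow (bilin Lam m m') *: Xpow (m + m').
Proof.
rewrite [LHS]tconvUU mulr1; apply/malgP => k.
by rewrite mcoeffZ !mcoeffU mulrnAr.
Qed.

End QTorus.
Arguments Xpow {T Lam} m.

Definition posp (x : int) : int := Num.max x 0.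

Definition skew_symmetrizable (U : finType) (b : U -> U -> int) : Prop :=
  exists2 d : U -> int, forall k, 0 < d k &
    forall i j, d i * b i j = - (d j * b j i).

(* Quantum seeds with unfrozen vertices U and frozen vertices Fr, so that
   I = U + Fr.  Only the numerical data are recorded: the variables X_i are the
   formal ones of the quantum torus LP t below. *)
Record qseed (U Fr : finType) := QSeed {
  bt : U + Fr -> U -> int;
  lam : U + Fr -> U + Fr -> int;
  dd : U -> int;
  bt_rank : \rank (\matrix_(i < #|{: U + Fr}|, j < #|U|)
                      ((bt (enum_val i) (enum_val j))%:~R : rat)) = #|U|;
  bt_skew : skew_symmetrizable (fun i j => bt (inl i) j);
  lam_skew : forall i j, lam i j = - lam j i;
  dd_gt0 : forall k, 0 < dd k;
  bt_lam : forall (k : U) (j : U + Fr),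
    \sum_i bt i k * lam i j = if j == inl k then dd k else 0 }.

Section Seeds.
Context (U Fr : finType).
Notation I := (U + Fr)%type.
Implicit Types (t : qseed U Fr) (k : U).

(* the exponent \tilde B n of Y^n *)
Definition btv t (n : 'Z^U) : 'Z^I := [ffun i => \sum_k bt t i k * n k].

(* the coordinates of f'_i in the basis (f_j) *)
Definition mut_f t k (i : I) : 'Z^I :=
  if i == inl k then - fvec (inl k) + \sum_j fvec j *~ posp (- bt t j k)
  else fvec i.

Definition mut_bt t k (i : I) (j : U) : int :=
  if (i == inl k) || (j == k) then - bt t i j
  else bt t i j + bt t i k * posp (bt t (inl k) j) + posp (- bt t i k) * bt t (inl k) j.

Definition mut_lam t k (i j : I) : int := bilin (lam t) (mut_f t k i) (mut_f t k j).

Lemma pospM (d x : int) : 0 < d -> posp (d * x) = d * posp x.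
Proof. by move=> d0; rewrite /posp maxr_pMr ?mulr0 // ltW. Qed.

Lemma bilinE (T : finType) (Lam : T -> T -> int) (p m : 'Z^T) :
  bilin Lam p m = \sum_j m j * bilin Lam p (fvec j).
Proof.
rewrite {1}/bilin exchange_big; apply: eq_bigr => j _ /=.
rewrite /bilin big_distrr /=; apply: eq_bigr => i _.
rewrite (bigD1 j) //= big1 ?ffunE ?eqxx ?mulr1n ?addr0 => [|j' /negPf nj]; first by ring.
by rewrite !ffunE eq_sym nj mulr0 mul0r.
Qed.

Lemma bilin_skew (T : finType) (Lam : T -> T -> int) :
  (forall i j, Lam i j = - Lam j i) -> forall p m, bilin Lam p m = - bilin Lam m p.
Proof.
move=> sk p m; rewrite /bilin exchange_big -sumrN; apply: eq_bigr => j _ /=.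
by rewrite -sumrN; apply: eq_bigr => i _; rewrite sk; ring.
Qed.

Lemma bilin_suml (T J : finType) (Lam : T -> T -> int) (E : J -> 'Z^T) (e : J -> int) m :
  bilin Lam (\sum_i E i *~ e i) m = \sum_i e i * bilin Lam (E i) m.
Proof.
pose f x := bilin Lam x m.
have fD : {morph f : x y / x - y}.
  by move=> x y; rewrite /f bilinDl bilinNl.
pose fM := Algebra.isZmodMorphism.Build _ _ f fD.
pose fa : {additive _ -> _} := HB.pack f fM.
rewrite -[LHS]/(fa _) raddf_sum; apply: eq_bigr => i _.
by rewrite raddfMz /= -mulrzr mulrC intz.
Qed.

Let col t (j : U) : 'Z^I := [ffun i => bt t i j].

Let lam_col t j l :
  bilin (lam t) (col t j) (fvec l) = if l == inl j then dd t j else 0.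
Proof.
rewrite -bt_lam /bilin; apply: eq_bigr => i _.
rewrite (bigD1 l) //= big1 ?ffunE ?eqxx ?mulr1 ?addr0 // => l' /negPf nl.
by rewrite !ffunE eq_sym nl mulr0 mul0r.
Qed.

Let lam_colv t j m : bilin (lam t) (col t j) m = dd t j * m (inl j).
Proof.
rewrite bilinE (bigD1 (inl j)) //= big1 => [|l /negPf nl].
  by rewrite lam_col eqxx addr0 mulrC.
by rewrite lam_col nl mulr0.
Qed.

Lemma dd_bt_skew t i j : dd t i * bt t (inl i) j = - (dd t j * bt t (inl j) i).
Proof.
have := bilin_skew (lam_skew t) (col t i) (col t j).
by rewrite !lam_colv !ffunE.
Qed.

Let bt_diag t k : bt t (inl k) k = 0.
Proof.
have := dd_bt_skew t k k; have := dd_gt0 t k => d0 H.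
have : dd t k * bt t (inl k) k = 0 by lra.
by move/eqP; rewrite mulf_eq0 (gt_eqF d0) => /eqP.
Qed.

Let posp0 : posp 0 = 0. Proof. by rewrite /posp maxxx. Qed.

Let mut_fk t k (l : I) :
  mut_f t k (inl k) l = if l == inl k then -1 else posp (- bt t l k).
Proof.
rewrite /mut_f eqxx !ffunE sum_ffunE (bigD1 l) //= ffunMzE ffunE eqxx big1.
  rewrite addr0 eq_sym; case: eqP => [->|_]; rewrite intz ?oppr0 ?add0r //.
  by rewrite bt_diag oppr0 posp0 addr0.
by move=> l' /negPf nl; rewrite ffunMzE ffunE nl mul0rz.
Qed.

Let mut_col t k j : \sum_i mut_f t k i *~ mut_bt t k i j =
  if j == k then - col t k else col t j + col t k *~ posp (bt t (inl k) j).
Proof.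
apply/ffunP => l; rewrite sum_ffunE (bigD1 (inl k)) //= ffunMzE mut_fk.
rewrite {1}/mut_bt eqxx /= -[X in X + _]mulrzr intz.
have -> : \sum_(i | i != inl k) (mut_f t k i *~ mut_bt t k i j) l =
   if l == inl k then 0 else mut_bt t k l j.
  case: ifP => [/eqP ->|/negbT nl].
    rewrite big1 // => i ni; rewrite ffunMzE /mut_f (negPf ni) ffunE (negPf ni).
    by rewrite mul0rz.
  rewrite (bigD1 l) //= big1 => [|i /andP[ni /negPf il]].
    by rewrite ffunMzE /mut_f (negPf nl) ffunE eqxx intz addr0.
  by rewrite ffunMzE /mut_f (negPf ni) ffunE il mul0rz.
rewrite /mut_bt; case: (eqVneq j k) => [->|njk].
  rewrite !ffunE bt_diag; case: eqP => [->|_] /=; rewrite ?bt_diag; first by ring.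
  by ring.
rewrite !ffunE ffunMzE ffunE -mulrzr intz.
by case: eqP => [->|_] /=; rewrite ?bt_diag; ring.
Qed.

Fact mut_bt_lam t k (j : U) (l : I) :
  \sum_i mut_bt t k i j * mut_lam t k i l = if l == inl j then dd t j else 0.
Proof.
rewrite /mut_lam -bilin_suml mut_col.
have key (j' : U) : bilin (lam t) (col t j') (mut_f t k l) =
    if l == inl k then dd t j' * (if j' == k then -1 else posp (- bt t (inl j') k))
    else if l == inl j' then dd t j' else 0.
  case: (eqVneq l (inl k)) => [->|nl].
    by rewrite lam_colv mut_fk (inj_eq inl_inj).
  by rewrite /mut_f (negPf nl) lam_col.
case: (eqVneq j k) => [->|njk].
  by rewrite bilinNl key eqxx; case: eqP => _; rewrite ?oppr0 //; ring.
rewrite bilinDl -[X in _ + X]/(bilin _ (col t k *~ _) _).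
have -> : forall x (e : int) m, bilin (lam t) (x *~ e) m = e * bilin (lam t) x m.
  move=> x e m.
  have := bilin_suml (lam t) (fun _ : 'I_1 => x) (fun _ => e) m.
  by rewrite !big_ord1.
rewrite !key eqxx (negPf njk); case: (eqVneq l (inl k)) => [->|nl].
  rewrite (inj_eq inl_inj) eq_sym (negPf njk) -pospM ?dd_gt0 //.
  rewrite mulrN dd_bt_skew opprK pospM ?dd_gt0 //; ring.
by rewrite mulr0 addr0.
Qed.

Fact mut_lam_skew t k i j : mut_lam t k i j = - mut_lam t k j i.
Proof. exact/bilin_skew/lam_skew. Qed.

Section FromCompat.
Context (b : I -> U -> int) (L : I -> I -> int) (d : U -> int).
Hypothesis L_skew : forall i j, L i j = - L j i.
Hypothesis d_gt0 : forall k, 0 < d k.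
Hypothesis b_L : forall (k : U) (j : I),
    \sum_i b i k * L i j = if j == inl k then d k else 0.

Fact compat_rank :
  \rank (\matrix_(i < #|{: I}|, j < #|U|)
            ((b (enum_val i) (enum_val j))%:~R : rat)) = #|U|.
Proof.
apply/eqP; rewrite -[_ == _]/(row_full _) -sub1mx; apply/submxP.
exists (\matrix_(j < #|U|, i < #|{: I}|)
   ((L (enum_val i) (inl (enum_val j)))%:~R / (d (enum_val j))%:~R : rat)).
apply/matrixP => j k; rewrite !mxE.
under eq_bigr => i _ do rewrite !mxE mulrAC -rmorphM /= mulrC.
rewrite -big_distrr /=.
have -> : \sum_(i < #|{: I}|) (L (enum_val i) (inl (enum_val j)) *
   b (enum_val i) (enum_val k))%:~R =
   (\sum_i b i (enum_val k) * L i (inl (enum_val j)))%:~R :> rat.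
  rewrite rmorph_sum /= [RHS](reindex (fun i : 'I_#|{: I}| => enum_val i)) /=.
    by apply: eq_bigr => i _; rewrite mulrC.
  by exists enum_rank => x _; rewrite ?enum_valK ?enum_rankK.
rewrite b_L (inj_eq inl_inj) (inj_eq enum_val_inj).
case: eqP => [->|_]; last by rewrite mulr0.
by rewrite mulVf // intr_eq0 gt_eqF.
Qed.

Fact compat_skew : skew_symmetrizable (fun i j => b (inl i) j).
Proof.
exists d => // i j.
pose cl (j : U) : 'Z^I := [ffun i => b i j].
have clv j0 m : bilin L (cl j0) m = d j0 * m (inl j0).
  rewrite bilinE (bigD1 (inl j0)) //= big1 => [|l /negPf nl].
    rewrite addr0 mulrC; congr (_ * _).
    have := b_L j0 (inl j0); rewrite eqxx => <-.
    rewrite /bilin; apply: eq_bigr => i0 _; rewrite (bigD1 (inl j0)) //= big1.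
      by rewrite !ffunE eqxx mulr1 addr0.
    by move=> l /negPf nl; rewrite !ffunE eq_sym nl mulr0 mul0r.
  rewrite (_ : bilin _ _ _ = 0) ?mulr0 //.
  have := b_L j0 l; rewrite nl => <-.
  rewrite /bilin; apply: eq_bigr => i0 _; rewrite (bigD1 l) //= big1.
    by rewrite !ffunE eqxx mulr1 addr0.
  by move=> l' /negPf nl'; rewrite !ffunE eq_sym nl' mulr0 mul0r.
have := bilin_skew L_skew (cl i) (cl j).
by rewrite !clv !ffunE.
Qed.

End FromCompat.

Definition mutate k t : qseed U Fr :=
  @QSeed U Fr (mut_bt t k) (mut_lam t k) (dd t)
    (compat_rank (@dd_gt0 _ _ t) (mut_bt_lam t k))
    (compat_skew (mut_lam_skew t k) (@dd_gt0 _ _ t) (mut_bt_lam t k))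
    (mut_lam_skew t k) (@dd_gt0 _ _ t) (mut_bt_lam t k).

End Seeds.

(* A skew field of fractions of an R-algebra A, in the sense of right fractions
   a b^-1; it is determined by A up to a unique isomorphism over A. *)
Record frac_skew_field (R : comNzRingType) (A : algType R) := FracSkewField {
  fsf_sort :> unitAlgType R;
  fsf_emb : {lrmorphism A -> fsf_sort};
  fsf_inj : injective fsf_emb;
  fsf_unit : forall x : fsf_sort, x != 0 -> x \is a GRing.unit;
  fsf_frac : forall x : fsf_sort,
    exists a b : A, b != 0 /\ x = fsf_emb a / fsf_emb b }.

Local Open Scope classical_set_scope.

Section Degrees.
Context (U Fr : finType).
Notation I := (U + Fr)%type.
Implicit Types (t : qseed U Fr) (k : U).

Definition LP t := qtorus (lam t).

Definition Xvar t (i : I) : LP t := Xpow (fvec i).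
Definition Ypow t (n : 'Z^U) : LP t := Xpow (btv t n).
Definition Yvar t k : LP t := Ypow t (fvec k).

Definition nonneg (T : finType) (m : 'Z^T) : Prop := forall i, 0 <= m i.

(* m' is below m for the dominance order of t *)
Definition preceq t (m' m : 'Z^I) : Prop :=
  exists2 n : 'Z^U, nonneg n & m' = m + btv t n.
Definition prec t (m' m : 'Z^I) : Prop := preceq t m' m /\ m' <> m.

Definition pointed t (g : 'Z^I) (Z : LP t) : Prop :=
  exists c : {malg kk['Z^U]},
    (forall n, n \in msupp c -> nonneg n /\ n <> 0) /\
    Z = cmul (Xpow g) (1 + \sum_(n <- msupp c) c@_n *: Ypow t n).

Definition max_degree t (Z : LP t) (m : 'Z^I) : Prop :=
  m \in msupp Z /\ forall m', m' \in msupp Z -> ~ prec t m m'.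

(* Z' = [Z]^t; Z' is unique, kk being a domain *)
Definition normalization t (Z Z' : LP t) : Prop :=
  exists m, [/\ max_degree Z m, forall m', max_degree Z m' -> m' = m
              & Z@_m *: Z' = Z].

(* A sequence of mutations is applied from right to left:
   mutates [:: k_r; ...; k_1] t = mu_(k_r) ... mu_(k_1) t. *)
Fixpoint mutates (ks : seq U) t : qseed U Fr :=
  if ks is k :: ks' then mutate k (mutates ks' t) else t.

(* phi_(t',t) for t' = mu_k t *)
Definition trop t k (g : 'Z^I) : 'Z^I :=
  [ffun i => if i == inl k then - g (inl k)
             else if 0 <= g (inl k) then g i + posp (bt t i k) * g (inl k)
             else g i + posp (- bt t i k) * g (inl k)].

Fixpoint trops (ks : seq U) t (g : 'Z^I) : 'Z^I :=
  if ks is k :: ks' then trop (mutates ks' t) k (trops ks' t g) else g.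

Definition frozen_exp (u : 'Z^Fr) : 'Z^I :=
  [ffun i => if i is inr j then u j else 0].

Definition similar (sigma : {perm U}) t t' : Prop :=
  (forall i j, bt t' (inl (sigma i)) (sigma j) = bt t (inl i) j) /\
  (forall k, dd t' (sigma k) = dd t k).

End Degrees.
Arguments pointed {U Fr} t g Z.
Arguments normalization {U Fr} t Z Z'.
Arguments frozen_exp {U Fr} u.

Definition subalgebra (R : comNzRingType) (E : algType R) (A : set E) : Prop :=
  [/\ A 1, forall (c : R) x y, A x -> A y -> A (c *: x + y)
         & forall x y, A x -> A y -> A (x * y)].

Definition is_basis (R : comNzRingType) (E : algType R) (J : choiceType)
    (A : set E) (b : J -> E) : Prop :=
  [/\ forall j, A (b j),
      forall c : {malg R[J]}, \sum_(j <- msupp c) c@_j *: b j = 0 -> c = 0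
    & forall x, A x -> exists c : {malg R[J]}, x = \sum_(j <- msupp c) c@_j *: b j].

(* a choice of the skew field F(t) for every seed t *)
Definition skew_fields (U Fr : finType) : Type :=
  forall t : qseed U Fr, frac_skew_field (LP t).

(* mu_k^* : F(mu_k t) -> F(t); the values on the variables determine the map *)
Record mutation_iso (U Fr : finType) (F : skew_fields U Fr)
    (t : qseed U Fr) (k : U) := MutationIso {
  mi_map :> {lrmorphism F (mutate k t) -> F t};
  mi_bij : bijective mi_map;
  mi_X : forall i : U + Fr, i != inl k ->
    mi_map (fsf_emb (F (mutate k t)) (Xvar (mutate k t) i)) = fsf_emb (F t) (Xvar t i);
  mi_Xk : mi_map (fsf_emb (F (mutate k t)) (Xvar (mutate k t) (inl k))) =
    fsf_emb (F t)
      (Xpow (- fvec (inl k) + \sum_j fvec j *~ posp (- bt t j k)) +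
       Xpow (- fvec (inl k) + \sum_j fvec j *~ posp (bt t j k))) }.

Section Bases.
Context (U Fr : finType) (F : skew_fields U Fr)
  (mu : forall t k, mutation_iso F t k).
Notation I := (U + Fr)%type.
Implicit Types (t : qseed U Fr) (ks : seq U).

Local Notation iota t := (fsf_emb (F t)).

(* mu^*_(t',t) : F(t') -> F(t) for t' = mutates ks t; a subset S of F(t) has
   the image  mustar ks t @^-1` S  under the inverse map mu^*_(t,t'). *)
Fixpoint mustar ks t : F (mutates ks t) -> F t :=
  match ks return F (mutates ks t) -> F t with
  | [::] => id
  | k :: ks' => fun x : F (mutate k (mutates ks' t)) =>
      @mustar ks' t (mu (mutates ks' t) k x)
  end.
Arguments mustar : clear implicits.

(* Delta^+ is exhausted by the seeds  mutates ks t *)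
Definition upper_cluster_algebra t : set (F t) :=
  \bigcap_ks (mustar ks t @` range (iota (mutates ks t))).

(* mutates ks t is t[1] *)
Definition is_shift t ks : Prop :=
  exists sigma : {perm U}, forall k, exists g (Z : LP t),
    [/\ mustar ks t (iota (mutates ks t) (Xvar (mutates ks t) (inl (sigma k)))) = iota t Z,
        pointed t g Z
      & forall j : U, g (inl j) = - fvec k j].

Definition injective_reachable t : Prop := exists ks, is_shift t ks.

(* the quantum cluster monomials of mutates ks t, in F(t) *)
Definition cluster_monomials t ks : set (F t) :=
  [set mustar ks t (iota (mutates ks t) (Xpow m)) | m in [set m : 'Z^I | nonneg m]].
Arguments cluster_monomials : clear implicits.

Definition triangular_basis t (A L : set (F t)) : Prop :=
  exists b : 'Z^I -> LP t,
    (L = range (iota t \o b) /\ is_basis A (iota t \o b)) /\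
    [/\ forall g, bar (Lam := lam t) (b g) = b g,
        cluster_monomials t [::] `<=` L /\
          (exists2 ks, is_shift t ks & cluster_monomials t ks `<=` L),
        forall g, pointed t g (b g)
      & forall i g, exists c : {malg kk['Z^I]},
          (forall g', g' \in msupp c -> prec t g' (g + fvec i) /\ in_m c@_g') /\
          normalization t (Xvar t i * b g)
            (b (g + fvec i) + \sum_(g' <- msupp c) c@_g' *: b g')].

(* compatibility of pointed sets S at t and S' at t' = mutates ks t *)
Definition compatible t ks (S : set (F t)) (S' : set (F (mutates ks t))) : Prop :=
  forall g (Z : LP t) (Z' : LP (mutates ks t)),
    S (iota t Z) -> pointed t g Z ->
    S' (iota (mutates ks t) Z') -> pointed (mutates ks t) (trops ks t g) Z' ->
    iota t Z = mustar ks t (iota (mutates ks t) Z').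

Definition common_triangular_basis t (A L : set (F t)) : Prop :=
  (forall ks, triangular_basis (mustar ks t @^-1` A) (mustar ks t @^-1` L)) /\
  (forall ks1 ks2, let L1 := mustar ks1 t @^-1` L in
     compatible (ks := ks2) L1 (mustar ks2 (mutates ks1 t) @^-1` L1)).

(* the group of frozen factors *)
Definition frozen_factors t : set (F t) :=
  range (fun u : 'Z^Fr => iota t (Xpow (frozen_exp u))).
Arguments frozen_factors : clear implicits.

Definition variation_map (sigma : {perm U}) t t'
    (var : {lrmorphism F t -> F t'}) : Prop :=
  [/\ bijective var,
      forall k, exists u : 'Z^Fr, var (iota t (Xvar t (inl k))) =
        iota t' (cmul (Xpow (frozen_exp u)) (Xvar t' (inl (sigma k)))),
      forall k, var (iota t (Yvar t k)) = iota t' (Yvar t' (sigma k))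
    & var @` frozen_factors t = frozen_factors t'].

Definition twist_automorphism t (tw : F t -> F t) : Prop :=
  exists ks (sigma : {perm U}) (var : {lrmorphism F t -> F (mutates ks t)}),
    [/\ similar sigma t (mutates ks t), variation_map sigma var
      & forall x, tw x = mustar ks t (var x)].

End Bases.

Arguments mustar {U Fr F} mu ks t.
Arguments upper_cluster_algebra {U Fr F} mu t.
Arguments injective_reachable {U Fr F} mu t.
Arguments common_triangular_basis {U Fr F} mu {t} A L.
Arguments twist_automorphism {U Fr F} mu {t} tw.

(* Main.v *)
Require Import Defs.
From HB Require Import structures.
From mathcomp Require Import all_boot all_order all_algebra all_fingroup.
From mathcomp Require Import finmap zify ring lra monalg.
From mathcomp Require Import boolp classical_sets functions.

(* Write t' for the seed of a twist automorphism tw = mustar o var; it suffices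
   that var maps the triangular basis L of t onto the triangular basis L' of t'.

   On monomials var is X^m |-> X^(psi m) for a linear bijection psi preserving
   lambda, the dominance order and frozen degrees.  Mutation at k on one side and
   at sigma k on the other preserves this shape, so var sends the cluster of
   mutates ks t to that of mutates (map sigma ks) t', up to frozen factors.  Since
   L' is triangular for every seed, it contains these images; taking
   mutates ks t = t[1], one gets for each n >= 0 an element of L with unfrozen
   degree -n whose image lies in L'.  Multiplying it by a monomial X^m, condition
   (4) expands one and the same element unitriangularly, with coefficients in m,
   both in var L and in L'; as any degree is reached in this way, Lusztig's
   uniqueness of bar-invariant bases gives var L = L'. *)

Set Implicit Arguments.
Unset Strict Implicit.
Unset Printing Implicit Defensive.

Import Order.TTheory GRing.Theory Num.Theory.
Local Open Scope ring_scope.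
Local Open Scope classical_set_scope.

(** * Integer combinations and scalar bookkeeping *)

Lemma fvec_expand (T : finType) (m : 'Z^T) : m = \sum_i fvec i *~ m i.
Proof.
apply/ffunP => j; rewrite sum_ffunE (bigD1 j) //= ffunMzE ffunE eqxx big1.
  by rewrite addr0 intz.
by move=> i /negPf ij; rewrite ffunMzE ffunE ij mul0rz.
Qed.

Lemma mulrz_closed (V : zmodType) (P : V -> Prop) : P 0 ->
  (forall x y, P x -> P y -> P (x + y)) -> (forall x, P x -> P (- x)) ->
  forall x z, P x -> P (x *~ z).
Proof.
move=> P0 PD PN x z Px.
have PMn n : P (x *+ n) by elim: n => [|n IH]; rewrite ?mulrS //; exact: PD.
by case: z => n; [exact: PMn|rewrite NegzE mulrNz; exact/PN/PMn].
Qed.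

Section AlgebraIdentities.
Context (R : comNzRingType) (E : algType R).

Lemma scale_can_inj (V : lmodType R) (a a' : R) : a' * a = 1 -> injective (@GRing.scale R V a).
Proof.
by move=> aa; apply: (@can_inj _ _ _ ( *:%R a')) => Z; rewrite scalerA aa scale1r.
Qed.

Lemma mulr_add_scale (X y y1 W W1 W2 : E) (a u u' e : R) :
  X * y = u' *: (y1 + W1) -> X * W = u *: W2 -> a * u' = u * e ->
  X * (a *: y + W) = u *: (e *: y1 + e *: W1 + W2).
Proof.
move=> Ey EW Ea.
by rewrite mulrDr EW -scalerAr Ey scalerA Ea -scalerA -scalerDr [e *: (y1 + W1)]scalerDr.
Qed.

Lemma scale_mul_add (Xp Xq y y1 y2 W W1 W2 : E) (u v1 v2 w : R) :
  Xq * y = v1 *: (y1 + W) -> Xp * y1 = v2 *: (y2 + W1) -> Xp * W = v2 *: W2 ->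
  u * v1 * v2 = w -> u *: (Xp * Xq) * y = w *: (y2 + (W1 + W2)).
Proof.
move=> E1 E2 E3 <-.
by rewrite -scalerAl -(mulrA Xp) E1 -scalerAr mulrDr E2 E3 -scalerDr !scalerA addrA.
Qed.

Lemma scale_add_scale (a e : R) (y W : E) : e *: (a *: y + W) = (e * a) *: y + e *: W.
Proof. by rewrite scalerDr scalerA. Qed.

End AlgebraIdentities.

(** * Coefficients of a twisted convolution *)

Section Convolution.
Context (K : zmodType) (R : comNzRingType) (c : K -> K -> R).

Lemma mcoeff_tconv (f g : {malg R[K]}) x :
  (tconv c f g)@_x = \sum_(a <- msupp f) c a (x - a) * (f@_a * g@_(x - a)).
Proof.
rewrite /tconv raddf_sum; apply: eq_bigr => a _ /=.
rewrite raddf_sum /= (eq_bigr (fun b => if b == x - a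
    then c a (x - a) * (f@_a * g@_(x - a)) else 0)); last first.
  move=> b _; have -> : (b == x - a) = (a + b == x).
    by rewrite eq_sym subr_eq addrC eq_sym.
  rewrite mcoeffU; case: eqP => [<-|//].
  by rewrite mulr1n addrAC subrr add0r.
case: (boolP (x - a \in msupp g)) => [xa|xa].
  rewrite (big_fsetD1 (x - a)) //= eqxx big_seq big1 ?addr0 // => b.
  by rewrite !inE => /andP[/negPf ->].
rewrite (mcoeff_outdom xa) !mulr0 big_seq big1 // => b bg.
by case: eqP => // E; rewrite E (negPf xa) in bg.
Qed.

Lemma mcoeff_tconvU (m : K) (g : {malg R[K]}) x :
  (tconv c << 1 *g m >> g)@_x = c m (x - m) * g@_(x - m).
Proof.
rewrite mcoeff_tconv msuppU oner_eq0 big_seq_fset1.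
by rewrite mcoeffUU mul1r.
Qed.

(** Serves both the bar involution on coefficients, where [h] is the sign change, and the transport
    of Laurent polynomials along an injective map of exponents. *)
Lemma mcoeff_relabel (J : choiceType) (g : {malg R[K]}) (h : K -> J) y : injective h ->
  (\sum_(k <- msupp g) << g@_k *g h k >>)@_(h y) = g@_y.
Proof.
move=> hI; rewrite raddf_sum /= (eq_bigr (fun k => if k == y then g@_y else 0)).
  case: (boolP (y \in msupp g)) => [yg|yg].
    rewrite (big_fsetD1 y) //= eqxx big_seq big1 ?addr0 // => b.
    by rewrite !inE => /andP[/negPf ->].
  rewrite big_seq big1 ?mcoeff_outdom // => b bg.
  by case: eqP => // E; rewrite E (negPf yg) in bg.
by move=> k _; rewrite mcoeffU (inj_eq hI); case: eqP => [->|].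
Qed.

End Convolution.

(** * The coefficient ring: powers of [v], bar involution, the subring [m] *)

Section Coefficients.
Implicit Types (x y : kk) (n : int).

Lemma mcoeff_vpow n x k : (vpow n * x)@_k = x@_(k - n).
Proof. by rewrite [LHS]mcoeff_tconvU mul1r. Qed.

Lemma vpow_neq0 n : vpow n != 0.
Proof. exact: malgU1_neq0. Qed.

Lemma vpow_inj : injective vpow.
Proof.
move=> m n /malgP /(_ m); rewrite !mcoeffU eqxx.
by case: eqP => // _ /eqP; rewrite oner_eq0.
Qed.

Lemma vpowVr n : vpow (- n) * vpow n = 1.
Proof. by rewrite -vpowD addNr vpow0. Qed.

Lemma mcoeff_kk_bar x n : (kk_bar x)@_n = x@_(- n).
Proof.
by rewrite -{1}(opprK n) /kk_bar mcoeff_relabel //; exact: oppr_inj.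
Qed.

Lemma kk_barB x y : kk_bar (x - y) = kk_bar x - kk_bar y.
Proof. by apply/malgP => n; rewrite mcoeffB !mcoeff_kk_bar mcoeffB. Qed.

Lemma in_mB x y : in_m x -> in_m y -> in_m (x - y).
Proof. by move=> mx my n n0; rewrite mcoeffB mx // my // subr0. Qed.

Lemma in_mD x y : in_m x -> in_m y -> in_m (x + y).
Proof. by move=> mx my n n0; rewrite mcoeffD mx // my // addr0. Qed.

Lemma in_m0 : in_m 0.
Proof. by move=> n _; rewrite mcoeff0. Qed.

Lemma in_m_vpow n x : n <= 0 -> in_m x -> in_m (vpow n * x).
Proof. by move=> n0 mx k k0; rewrite mcoeff_vpow mx //; lia. Qed.

Lemma in_mM (x y : kk) : in_m x -> in_m y -> in_m (x * y).
Proof.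
move=> mx my n n0; rewrite [LHS]mcoeff_tconv big1 // => a _.
case: (lerP 0 a) => a0; first by rewrite mx // mul0r mulr0.
by rewrite my ?mulr0 //; lia.
Qed.

(** Bar exchanges the coefficients of [v^n] and [v^-n], and in [m] those with [n >= 0] vanish.
    Uniqueness in Lusztig's lemma rests on this. *)
Lemma in_m_bar_eq0 x : in_m x -> kk_bar x = x -> x = 0.
Proof.
move=> mx bx; apply/malgP => n; rewrite mcoeff0.
case: (lerP 0 n) => [/mx //|n0].
by rewrite -bx mcoeff_kk_bar mx //; lia.
Qed.

End Coefficients.

(** * Monomials of a quantum torus *)

Section Torus.
Context (T : finType) (Lam : T -> T -> int).
Implicit Types (m x : 'Z^T) (f g : qtorus Lam).

Lemma mcoeff_Xpow m x : (Xpow m : qtorus Lam)@_x = (m == x)%:R.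
Proof. by rewrite mcoeffU. Qed.

Lemma mcoeff_XpowM m f x :
  (Xpow m * f)@_x = vpow (bilin Lam m (x - m)) * f@_(x - m).
Proof. exact: mcoeff_tconvU. Qed.

Lemma mcoeff_cmul m f x : (cmul (Xpow m) f)@_x = f@_(x - m).
Proof. by rewrite [LHS]mcoeff_tconvU mul1r. Qed.

Lemma cmul_Xpow m m' : cmul (Xpow m) (Xpow m') = Xpow (m + m') :> qtorus Lam.
Proof. by rewrite /cmul tconvUU !mulr1. Qed.

Lemma mcoeff_qtorusM f g x : (f * g)@_x =
  \sum_(a <- msupp f) vpow (bilin Lam a (x - a)) * (f@_a * g@_(x - a)).
Proof. exact: mcoeff_tconv. Qed.

Lemma mcoeff_bar f m : (bar f)@_m = kk_bar f@_m.
Proof.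
rewrite /bar.
case: (boolP (m \in msupp f)) => [mf|mf]; rewrite raddf_sum /=.
  rewrite (big_fsetD1 m) //= mcoeffUU big_seq big1 ?addr0 // => b.
  by rewrite !inE mcoeffU => /andP[/negPf ->].
rewrite big_seq big1 => [|b bf].
  by rewrite mcoeff_outdom // /kk_bar msupp0 big_seq_fset0.
by rewrite mcoeffU; case: eqP => // E; rewrite -E bf in mf.
Qed.

Lemma Xpow_inj : injective (@Xpow T Lam).
Proof.
move=> m n /malgP /(_ m); rewrite !mcoeffU eqxx.
by case: eqP => // _ /eqP; rewrite oner_eq0.
Qed.

Lemma XpowE m m' :
  Xpow (m + m') = vpow (- bilin Lam m m') *: (Xpow m * Xpow m') :> qtorus Lam.
Proof. by rewrite XpowM scalerA vpowVr scale1r. Qed.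

Lemma Xpow0 : Xpow 0 = 1 :> qtorus Lam. Proof. by []. Qed.

Lemma qtorus_expand f : f = \sum_(m <- msupp f) f@_m *: Xpow m.
Proof.
rewrite {1}(monalgE f); apply: eq_bigr => m _.
by apply/malgP => x; rewrite mcoeffZ !mcoeffU mulrnAr mulr1.
Qed.

End Torus.

(** * Dominance order, pointed elements and lower terms *)

Section Seed.
Context (U Fr : finType) (t : qseed U Fr).
Notation I := (U + Fr)%type.
Implicit Types (g h m x : 'Z^I) (n : 'Z^U).

(** The compatibility of [bt] and [lam] in computational form: pairing with the exponent of [Y^n]
    sees only unfrozen coordinates, with positive weights [dd]. Injectivity of [btv], the behaviour
    of frozen monomials and the signs of powers of [v] come from it. *)
Lemma bilin_btv n m :
  bilin (lam t) (btv t n) m = \sum_k dd t k * n k * m (inl k).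
Proof.
transitivity (\sum_k \sum_j n k * m j * \sum_i bt t i k * lam t i j).
  rewrite /bilin.
  transitivity (\sum_i \sum_k \sum_j n k * m j * (bt t i k * lam t i j)).
    apply: eq_bigr => i _; rewrite exchange_big; apply: eq_bigr => j _ /=.
    by rewrite ffunE !big_distrl; apply: eq_bigr => k _ /=; ring.
  rewrite exchange_big; apply: eq_bigr => k _; rewrite exchange_big.
  by apply: eq_bigr => j _; rewrite big_distrr.
apply: eq_bigr => k _; rewrite (bigD1 (inl k)) //= [X in _ + X]big1 => [|j /negPf nj].
  by rewrite bt_lam eqxx addr0; ring.
by rewrite bt_lam nj mulr0.
Qed.

Lemma bilin_btvr n m :
  bilin (lam t) m (btv t n) = - \sum_k dd t k * n k * m (inl k).
Proof. by rewrite (bilin_skew (@lam_skew _ _ t)) bilin_btv. Qed.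

Lemma btvD n n' : btv t (n + n') = btv t n + btv t n'.
Proof.
apply/ffunP => i; rewrite !ffunE -big_split; apply: eq_bigr => k _.
by rewrite ffunE mulrDr.
Qed.

Lemma btv0 : btv t 0 = 0.
Proof. by apply/ffunP => i; rewrite !ffunE big1 // => k _; rewrite ffunE mulr0. Qed.

Lemma btv_fvec k : btv t (fvec k) = [ffun i => bt t i k].
Proof.
apply/ffunP => i; rewrite !ffunE (bigD1 k) //= big1 => [|j /negPf nj].
  by rewrite ffunE eqxx mulr1 addr0.
by rewrite ffunE eq_sym nj mulr0.
Qed.

Lemma btv_expand n : btv t n = \sum_k btv t (fvec k) *~ n k.
Proof.
apply/ffunP => i; rewrite sum_ffunE ffunE; apply: eq_bigr => k _.
by rewrite ffunMzE btv_fvec ffunE -mulrzr intz.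
Qed.

Lemma btv_inj : injective (btv t).
Proof.
move=> n n' E; apply/ffunP => k.
have dn p : bilin (lam t) (btv t p) (fvec (inl k)) = dd t k * p k.
  rewrite bilin_btv (bigD1 k) //= big1 => [|j /negPf nj].
    by rewrite ffunE eqxx mulr1 addr0.
  by rewrite ffunE (inj_eq inl_inj) eq_sym nj mulr0.
have := dn n; rewrite E dn => /mulfI; rewrite gt_eqF ?dd_gt0 // => /(_ isT).
by move->.
Qed.

Lemma nonneg0 (T : finType) : nonneg (0 : 'Z^T).
Proof. by move=> i; rewrite ffunE. Qed.

Lemma nonnegD (T : finType) (p q : 'Z^T) : nonneg p -> nonneg q -> nonneg (p + q).
Proof. by move=> hp hq i; rewrite ffunE addr_ge0 ?hp ?hq. Qed.

Lemma preceq_refl g : preceq t g g.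
Proof. by exists 0; [exact: nonneg0|rewrite btv0 addr0]. Qed.

Lemma preceq_trans h g m : preceq t g h -> preceq t h m -> preceq t g m.
Proof.
move=> [n n0 ->] [n' n'0 ->]; exists (n' + n); first exact: nonnegD.
by rewrite btvD addrA.
Qed.

(** By injectivity of [btv] the two nonnegative shifts sum to zero, so both are zero. *)
Lemma preceq_antisym g h : preceq t g h -> preceq t h g -> g = h.
Proof.
move=> [n n0 ->] [n' n'0].
rewrite -[LHS]addr0 -addrA => /addrI; rewrite -btvD -btv0 => /btv_inj E.
suff -> : n = 0 by rewrite btv0 addr0.
apply/ffunP => k; move/ffunP: E => /(_ k); rewrite !ffunE.
by have := n0 k; have := n'0 k; lra.
Qed.

Lemma preceq_add g h m : preceq t g h -> preceq t (g + m) (h + m).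
Proof. by move=> [n n0 ->]; exists n => //; rewrite addrAC. Qed.

Lemma preceqD g h g' h' :
  preceq t g h -> preceq t g' h' -> preceq t (g + g') (h + h').
Proof.
move=> gh gh'; apply: preceq_trans (preceq_add h' gh).
by rewrite ![g + _]addrC; exact: preceq_add.
Qed.

Lemma prec_add g h m : prec t g h -> prec t (g + m) (h + m).
Proof. by move=> [gh ne]; split; [exact: preceq_add|move/addIr]. Qed.

Lemma prec_preceq_trans g h m : prec t g h -> preceq t h m -> prec t g m.
Proof.
move=> [gh ne] hm; split; first exact: preceq_trans hm.
by move=> E; apply: ne; apply: preceq_antisym => //; rewrite E.
Qed.

(** Pointedness read on coefficients, a form easier to transport along monomial maps than the
    witness in [pointed]. *)
Definition ltriang g (Z : LP t) : Prop :=
  Z@_g = 1 /\ forall x, Z@_x != 0 -> preceq t x g.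

Lemma pointed_ltriang g Z : pointed t g Z -> ltriang g Z.
Proof.
move=> [c [c_pos ->]].
have coefS y : (\sum_(n <- msupp c) c@_n *: Ypow t n)@_y =
    \sum_(n <- msupp c) c@_n * (btv t n == y)%:R.
  rewrite raddf_sum; apply: eq_bigr => n _.
  by rewrite /= mcoeffZ mcoeff_Xpow.
have coef1 (y : 'Z^I) : (1 : LP t)@_y = (0 == y)%:R by rewrite -Xpow0 mcoeff_Xpow.
split=> [|x]; rewrite mcoeff_cmul mcoeffD coef1 coefS.
  rewrite subrr eqxx big_seq big1 ?addr0 // => n /c_pos[_ nz].
  by case: eqP => [E|_]; rewrite ?mulr0 //; case: nz; apply: btv_inj; rewrite btv0.
case: (eqVneq 0 (x - g)) => [/esym/eqP|_ nz].
  by rewrite subr_eq0 => /eqP -> _; exact: preceq_refl.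
case/boolP: [exists i : msupp c, btv t (val i) == x - g].
  move/existsP => [i /eqP E]; have [n0 _] := c_pos _ (valP i).
  by exists (val i) => //; rewrite E addrC subrK.
rewrite negb_exists => /forallP H; move: nz; rewrite big_seq big1 ?addr0 ?eqxx //.
by move=> n nc; rewrite (negPf (H [` nc]%fset)) mulr0.
Qed.

Lemma ltriang_deg_inj g h Z : ltriang g Z -> ltriang h Z -> g = h.
Proof.
move=> [g1 gle] [h1 hle]; apply: preceq_antisym.
  by apply: hle; rewrite g1 oner_neq0.
by apply: gle; rewrite h1 oner_neq0.
Qed.

(** If [a] lies below [g] and [g + h - a] below [h], antisymmetry forces [a = g]; a single pair of
    terms contributes at [g + h]. *)
Lemma mcoeffM_ltriang g h (Y Z : LP t) : ltriang g Y -> ltriang h Z ->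
  (Y * Z)@_(g + h) = vpow (bilin (lam t) g h) /\
  forall x, (Y * Z)@_x != 0 -> preceq t x (g + h).
Proof.
move=> [g1 gle] [h1 hle]; split=> [|x].
  have gY : g \in msupp Y by rewrite -mcoeff_neq0 g1 oner_neq0.
  rewrite mcoeff_qtorusM (big_fsetD1 g) //= big_seq big1 ?addr0.
    by rewrite [g + h - g]addrAC subrr add0r g1 h1 !mulr1.
  move=> a; rewrite !inE -mcoeff_neq0 => /andP[ag aY].
  case: (eqVneq Z@_(g + h - a) 0) => [->|]; first by rewrite !mulr0.
  move=> /hle E; case/negP: ag; apply/eqP/preceq_antisym; first exact: gle.
  by move/(preceq_add (a - h)): E; rewrite addrA subrK addrK addrCA subrr addr0.
case/boolP: [exists a : msupp Y, Z@_(x - val a) != 0].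
  move=> /existsP[a /hle xa] _; rewrite -[x](subrK (val a)) addrC.
  by apply: preceqD => //; apply: gle; rewrite mcoeff_neq0 (valP a).
rewrite negb_exists => /forallP H /negP[]; rewrite mcoeff_qtorusM big_seq big1 //.
by move=> a aY; have := H [` aY]%fset; rewrite negbK => /eqP ->; rewrite !mulr0.
Qed.

Lemma ltriang_Xpow g : ltriang g (Xpow g).
Proof.
split=> [|x]; rewrite mcoeff_Xpow; first by rewrite eqxx.
by case: (eqVneq g x) => [-> _|_ /eqP //]; exact: preceq_refl.
Qed.

(** The product has maximal degree [g + h], with a power of [v] as coefficient, and normalization
    divides by that power. *)
Lemma normalization_ltriang g h (Y Z W : LP t) : ltriang g Y -> ltriang h Z ->
  normalization t (Y * Z) W -> Y * Z = vpow (bilin (lam t) g h) *: W.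
Proof.
move=> gY hZ [m [_ mU <-]]; have [c1 cle] := mcoeffM_ltriang gY hZ.
rewrite -c1 (mU (g + h)) //; split=> [|m'].
  by rewrite -mcoeff_neq0 c1 vpow_neq0.
rewrite -mcoeff_neq0 => /cle m'gh [ghm' ne].
by apply: ne; apply: preceq_antisym.
Qed.

(** The error term of the triangularity condition (4). *)
Definition lower (b : 'Z^I -> LP t) g (W : LP t) : Prop :=
  exists c : {malg kk['Z^I]},
    (forall g', g' \in msupp c -> prec t g' g /\ in_m c@_g') /\
    W = \sum_(g' <- msupp c) c@_g' *: b g'.

Section Lower.
Context (b : 'Z^I -> LP t).

Let lcomb (c : {malg kk['Z^I]}) : LP t := \sum_(g' <- msupp c) c@_g' *: b g'.

Let lcombEw (S : {fset 'Z^I}) c : (msupp c `<=` S)%fset ->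
  lcomb c = \sum_(g' <- S) c@_g' *: b g'.
Proof.
move=> le; rewrite /lcomb (big_fset_incl _ le) //= => g' _ /mcoeff_outdom ->.
by rewrite scale0r.
Qed.

Lemma lower0 g : lower b g 0.
Proof. by exists 0; rewrite msupp0 big_seq_fset0. Qed.

Lemma lowerD g W W' : lower b g W -> lower b g W' -> lower b g (W + W').
Proof.
move=> [c [cP ->]] [c' [c'P ->]]; exists (c + c'); split=> [g'|].
  have cm (d : {malg kk['Z^I]}) :
      (forall h, h \in msupp d -> prec t h g /\ in_m d@_h) -> in_m d@_g'.
    by move=> dP; case: (msuppP d g') => [/dP[]//|_]; exact: in_m0.
  move=> g'S; split; last by rewrite mcoeffD; apply: in_mD; exact: cm.
  have := fsubsetP (msuppD_le c c') _ g'S; rewrite inE.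
  by case/orP => [/cP[]|/c'P[]].
rewrite -!/(lcomb _) (lcombEw (fsubsetUl (msupp c) (msupp c'))).
rewrite (lcombEw (fsubsetUr (msupp c) (msupp c'))) (lcombEw (msuppD_le c c')).
rewrite -big_split; apply: eq_bigr => g' _.
by rewrite mcoeffD scalerDl.
Qed.

Lemma lowerZ1 g g' (a : kk) : prec t g' g -> in_m a -> lower b g (a *: b g').
Proof.
move=> gg mx; exists << a *g g' >>; split=> [h|].
  move/(fsubsetP msuppU_le); rewrite inE => /eqP ->.
  by rewrite mcoeffUU.
by rewrite -[RHS]/(lcomb _) (lcombEw msuppU_le) big_seq_fset1 mcoeffUU.
Qed.

Lemma lower_ind g (P : LP t -> Prop) : P 0 ->
  (forall (a : kk) g' W, prec t g' g -> in_m a -> P W -> P (a *: b g' + W)) ->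
  forall W, lower b g W -> P W.
Proof.
move=> P0 PS W [c [cP ->]]; rewrite big_seq.
by elim/big_rec: _ => // g' W' /cP[? ?] PW; apply: PS.
Qed.

Lemma lowerZ g e W :
  in_m e -> lower b g W -> lower b g (e *: W).
Proof.
move=> me; elim/lower_ind => [|a g' W' gg ma IH].
  by rewrite (@scaler0 _ (LP t)); exact: lower0.
rewrite (@scale_add_scale _ (LP t)); apply: lowerD; last exact: IH.
by apply: lowerZ1 => //; exact: in_mM.
Qed.

End Lower.

End Seed.

Lemma sum_nonneg_gt0 (T : finType) (n : 'Z^T) : nonneg n -> n <> 0 -> 0 < \sum_k n k.
Proof.
move=> n0 nz; rewrite lt_neqAle sumr_ge0 ?andbT => [|k _]; last exact: n0.
apply/negP; rewrite eq_sym psumr_eq0 => [/allP H|k _]; last exact: n0.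
by apply: nz; apply/ffunP => k; rewrite ffunE; apply/eqP/H; rewrite mem_index_enum.
Qed.

(** * Lusztig's lemma and triangular families *)

Section Families.
Context (U Fr : finType) (t : qseed U Fr).
Notation I := (U + Fr)%type.
Local Notation bar := (bar (Lam := lam t)).
Local Notation cmul := (cmul (Lam := lam t)).
Implicit Types (g h m p x : 'Z^I) (n : 'Z^U) (b : 'Z^I -> LP t).

Lemma ltriang_coef_eq g x (Y Z : LP t) : ltriang g Y -> ltriang g Z ->
  (preceq t x g -> Y@_x = Z@_x) -> Y@_x = Z@_x.
Proof.
move=> [_ Yle] [_ Zle] H.
case: (eqVneq Y@_x 0) => [Y0|/Yle/H //].
by case: (eqVneq Z@_x 0) => [->|/Zle/H //].
Qed.

Lemma bar_fixP (Z : LP t) : bar Z = Z <-> forall x, kk_bar Z@_x = Z@_x.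
Proof.
split=> [{2}<- x|H]; first by rewrite (@mcoeff_bar _ (lam t)).
by apply/malgP => x; rewrite (@mcoeff_bar _ (lam t)).
Qed.

(** Splitting off the term at [x], where [b x] has coefficient one, isolates [c@_x]; the set [S]
    lets two expansions be summed over the same degrees. *)
Lemma mcoeff_lcombD (Y : LP t) (c : {malg kk['Z^I]}) b (S : {fset 'Z^I}) x :
  ltriang x (b x) -> (msupp c `<=` S)%fset -> x \in S ->
  (Y + \sum_(h <- msupp c) c@_h *: b h)@_x =
  Y@_x + (c@_x + \sum_(h <- (S `\ x)%fset) c@_h * (b h)@_x).
Proof.
move=> [b1 _] cS xS; rewrite mcoeffD; congr (_ + _).
transitivity (\sum_(h <- S) c@_h * (b h)@_x).
  rewrite -(big_fset_incl _ cS) => [|h _ /mcoeff_outdom ->]; last by rewrite mul0r.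
  by rewrite raddf_sum; apply: eq_bigr => h _; exact: mcoeffZ.
by rewrite (big_fsetD1 x xS) /= b1 mulr1.
Qed.

(* Lusztig's lemma: dominance intervals are finite, so one can induct on the
   distance from the leading degree g: the coefficients of b g and b' g at a
   given degree differ by an element of m, which is bar-invariant, hence 0. *)
Lemma bar_invariant_unique b b' :
  (forall g, ltriang g (b g)) -> (forall g, ltriang g (b' g)) ->
  (forall g, bar (b g) = b g) -> (forall g, bar (b' g) = b' g) ->
  (forall g, exists W W', [/\ lower b g W, lower b' g W' & b g + W = b' g + W']) ->
  b =1 b'.
Proof.
move=> bT b'T bB b'B tri.
have low_choice (d : 'Z^I -> LP t) g W : lower d g W ->
    exists c : {malg kk['Z^I]}, (forall h, h \in msupp c -> prec t h g) /\
      (forall h, in_m c@_h) /\ W = \sum_(h <- msupp c) c@_h *: d h.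
  move=> [c [cP ->]]; exists c; split; [by move=> h /cP[]|split=> // h].
  by case: (msuppP c h) => [/cP[]//|_]; exact: in_m0.
pose good g (c c' : {malg kk['Z^I]}) :=
  [/\ forall h, h \in (msupp c `|` msupp c')%fset -> prec t h g,
      forall h, in_m c@_h /\ in_m c'@_h
    & b g + \sum_(h <- msupp c) c@_h *: b h =
      b' g + \sum_(h <- msupp c') c'@_h *: b' h].
have [c [c' cP]] : exists c c', forall g, good g (c g) (c' g).
  suff /choice[c cP] : forall g, exists cc, good g cc.1 cc.2.
    by exists (fun g => (c g).1), (fun g => (c g).2).
  move=> g; have [W [W' [/low_choice [c [c1 [c2 ->]]]]]] := tri g.
  move=> /low_choice [c' [c1' [c2' ->]]] E.
  exists (c, c'); split=> [h|h|]; [|by split|exact: E].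
  by rewrite inE => /orP[/c1|/c1'].
(* Both equalities are proved together and for all [g]: the step at [g] also needs the Laurent
   coefficients of [b h] for lower [h]. *)
suff key (N : nat) g n : nonneg n -> \sum_k n k < N%:Z ->
    (b g)@_(g + btv t n) = (b' g)@_(g + btv t n) /\
    (c g)@_(g + btv t n) = (c' g)@_(g + btv t n).
  move=> g; apply/malgP => x; apply: (ltriang_coef_eq (bT g) (b'T g)).
  move=> [n n0 ->]; have s0 : 0 <= \sum_k n k by apply: sumr_ge0 => k _; exact: n0.
  by have [] := key `|\sum_k n k|.+1 g n n0 ltac:(lia).
elim: N g n => [|N IH] g n n0 nN.
  have s0 : 0 <= \sum_k n k by apply: sumr_ge0 => k _; exact: n0.
  by exfalso; lia.
have [x xE] : exists x, x = g + btv t n by exists (g + btv t n).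
rewrite -xE.
have [cS cm cE] := cP g.
set S := (x |` (msupp (c g) `|` msupp (c' g)))%fset.
have xS : x \in S by exact: fset1U1.
have S1 : (msupp (c g) `<=` S)%fset by rewrite /S fsetUCA fsubsetUl.
have S2 : (msupp (c' g) `<=` S)%fset by rewrite /S fsetUA fsetUC fsubsetUl.
have E := etrans (esym (mcoeff_lcombD (b g) (bT x) S1 xS))
  (etrans (congr1 (mcoeff x) cE) (mcoeff_lcombD (b' g) (b'T x) S2 xS)).
have {}E : (b g)@_x + (c g)@_x = (b' g)@_x + (c' g)@_x.
  move: E; set R := \sum_(h <- _) _; set R' := \sum_(h <- _) _.
  suff -> : R = R' by rewrite !addrA => /addIr.
  (* A term that does not vanish has [x] strictly below [h] and [h] strictly below [g]. Both gaps
     are shorter than [n], so induction applies to the pairs [g], [h] and [h], [x]. *)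
  rewrite /R /R' [LHS]big_seq [RHS]big_seq; apply: eq_bigr => h.
  rewrite in_fsetD1 in_fset1U => /andP[hx]; rewrite (negPf hx) orFb.
  move=> /cS [[n' n'0 hE] hg].
  case: (pselect (preceq t x h)) => [[n'' n''0 xhE]|xh]; last first.
    have vanish (e : 'Z^I -> LP t) : ltriang h (e h) -> (e h)@_x = 0.
      by move=> [_ le]; apply/eqP; apply: contra_notT xh => /le.
    by rewrite !vanish ?mulr0.
  have nE : n = n' + n''.
    by apply: (@btv_inj _ _ t); apply: (addrI g); rewrite btvD addrA -hE -xE -xhE.
  have s' : 0 < \sum_k n' k.
    by apply: (sum_nonneg_gt0 n'0) => z; apply: hg; rewrite hE z btv0 addr0.
  have s'' : 0 < \sum_k n'' k.
    apply: (sum_nonneg_gt0 n''0) => z; case/eqP: hx.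
    by rewrite xhE z btv0 addr0.
  have sE : \sum_k n k = \sum_k n' k + \sum_k n'' k.
    by rewrite nE -big_split; apply: eq_bigr => k _; rewrite ffunE.
  have [_] := IH g n' n'0 ltac:(lia); rewrite -hE => IH1.
  by have [] := IH h n'' n''0 ltac:(lia); rewrite -xhE IH1 => -> _.
have [mx m'x] := cm x.
have E' : (b g)@_x - (b' g)@_x = (c' g)@_x - (c g)@_x.
  by apply/eqP; rewrite subr_eq addrAC eq_sym subr_eq E addrC.
have D0 : (b g)@_x - (b' g)@_x = 0.
  apply: in_m_bar_eq0; first by rewrite E'; exact: in_mB.
  by rewrite kk_barB !(bar_fixP _).1.
split; first by apply/eqP; rewrite -subr_eq0 D0.
by apply/esym/eqP; rewrite -subr_eq0 -E' D0.
Qed.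

(** Conditions (1), (3) and (4) of a triangular basis, with the normalization replaced by the
    explicit power of [v] that it divides by. *)
Definition triangular_family b : Prop :=
  [/\ forall g, ltriang g (b g), forall g, bar (b g) = b g
    & forall i g, exists2 W, lower b (fvec i + g) W &
        Xvar t i * b g = vpow (bilin (lam t) (fvec i) g) *: (b (fvec i + g) + W)].

(** A frozen [p] pairs to zero with every [btv t n], so all terms of [Z] acquire the same power of
    [v]. *)
Lemma XpowM_frozen p h (Z : LP t) : (forall j : U, p (inl j) = 0) -> ltriang h Z ->
  Xpow p * Z = vpow (bilin (lam t) p h) *: cmul (Xpow p) Z.
Proof.
move=> p0 [_ Zle]; apply/malgP => x; rewrite mcoeff_XpowM mcoeffZ mcoeff_cmul.
case: (eqVneq Z@_(x - p) 0) => [->|/Zle [n _ ->]]; first by rewrite !mulr0.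
rewrite bilinDr bilin_btvr big1 ?oppr0 ?addr0 // => k _.
by rewrite p0 mulr0.
Qed.

Section Triangular.
Context (b : 'Z^I -> LP t).
Hypothesis bT : triangular_family b.

Let b_ltri g : ltriang g (b g). Proof. by case: bT. Qed.
Let b_bar g : bar (b g) = b g. Proof. by case: bT. Qed.

(** Shifting [b] by a frozen variable gives another bar-invariant family of the same shape, and
    condition (4) at [inr j] compares the two; uniqueness identifies them, so no lower terms
    occur. *)
Lemma cmul_frozen_fvec (j : Fr) g : cmul (Xpow (fvec (inr j))) (b g) = b (fvec (inr j) + g).
Proof.
set f := fvec _; pose b' h := cmul (Xpow f) (b (h - f)).
have f0 (k : U) : f (inl k) = 0 by rewrite ffunE.
have b'T h : ltriang h (b' h).
  have [b1 ble] := b_ltri (h - f).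
  split=> [|x]; rewrite mcoeff_cmul // => /ble /(preceq_add f).
  by rewrite !subrK.
have -> : g = (f + g) - f by rewrite addrAC subrr add0r.
rewrite -/(b' (f + g)) [in RHS]addrAC subrr add0r; apply: bar_invariant_unique => // {}g.
  by apply/bar_fixP => x; rewrite mcoeff_cmul ((bar_fixP _).1 (b_bar _)).
exists 0; case: (bT) => _ _ /(_ (inr j) (g - f)) [W].
rewrite (XpowM_frozen f0 (b_ltri _)) addrC subrK => Wl E.
exists W; split; [exact: lower0|exact: Wl|].
by rewrite addr0; exact: (scale_can_inj (vpowVr _)) E.
Qed.

Definition Xpow_triangular p : Prop :=
  forall h, exists2 W, lower b (p + h) W &
    Xpow p * b h = vpow (bilin (lam t) p h) *: (b (p + h) + W).

Lemma Xpow_triangular0 : Xpow_triangular 0.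
Proof.
move=> h; exists 0; first exact: lower0.
by rewrite Xpow0 mul1r bilin0l vpow0 scale1r !(add0r, addr0).
Qed.

(** Passing from [g] to [g' = g + btv t n] changes the exponent of [v] by
    [- \sum_k dd t k * n k * p (inl k)]. The sign condition on [p] makes this nonpositive, so the
    coefficients stay in [m]. *)
Lemma Xpow_lower p g W : (forall j : U, 0 <= p (inl j)) -> Xpow_triangular p ->
  lower b g W -> exists2 W', lower b (p + g) W' &
    Xpow p * W = vpow (bilin (lam t) p g) *: W'.
Proof.
move=> p0 pT; elim/lower_ind: W / => [|a g' W gg ma [W' W'l W'E]].
  by exists 0; [exact: lower0|rewrite mulr0 scaler0].
have [W1 W1l W1E] := pT g'; have [[n n0 g'E] _] := gg.
pose e := vpow (- \sum_k dd t k * n k * p (inl k)) * a.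
have me : in_m e.
  apply: in_m_vpow => //; rewrite oppr_le0; apply: sumr_ge0 => k _.
  by rewrite !mulr_ge0 // ltW ?dd_gt0.
have pgg : prec t (p + g') (p + g) by rewrite ![p + _]addrC; exact: prec_add.
exists (e *: b (p + g') + e *: W1 + W').
  apply: lowerD => //; apply: lowerD; first exact: lowerZ1.
  apply: (lowerZ me); case: W1l => c [cP ->]; exists c; split=> // h /cP [hg ?].
  by split=> //; apply: prec_preceq_trans hg _; case: pgg.
apply: (mulr_add_scale W1E W'E).
by rewrite g'E bilinDr bilin_btvr vpowD /e; ring.
Qed.

Lemma Xpow_triangularD p q : (forall j : U, 0 <= p (inl j)) ->
  Xpow_triangular p -> Xpow_triangular q -> Xpow_triangular (p + q).
Proof.
move=> p0 pT qT h; have [W Wl WE] := qT h.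
have [W1 W1l W1E] := pT (q + h); have [W2 W2l W2E] := Xpow_lower p0 pT Wl.
rewrite -addrA; exists (W1 + W2); first exact: lowerD.
rewrite XpowE; apply: (scale_mul_add WE W1E W2E).
by rewrite -!vpowD bilinDl bilinDr; congr vpow; ring.
Qed.

Lemma Xpow_triangular_fvec i : Xpow_triangular (fvec i).
Proof. by case: bT => _ _ H h; exact: H. Qed.

(** Multiplication by a frozen variable only shifts the family, so it is undone without lower
    terms. *)
Lemma Xpow_triangular_fvecN (j : Fr) : Xpow_triangular (- fvec (inr j)).
Proof.
move=> h; exists 0; first exact: lower0.
rewrite (XpowM_frozen _ (b_ltri _)) => [|k]; last by rewrite !ffunE oppr0.
congr (_ *: _); rewrite addr0 -[in LHS](subrK (fvec (inr j)) h) [_ - _ + _]addrC.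
rewrite -cmul_frozen_fvec addrC; apply/malgP => x.
by rewrite !mcoeff_cmul opprK addrK.
Qed.

(** Frozen exponents may have either sign: both signs of a frozen basis vector are triangular, and
    [Xpow_triangularD] restricts unfrozen coordinates only. *)
Lemma Xpow_triangular_nonneg p : (forall j : U, 0 <= p (inl j)) -> Xpow_triangular p.
Proof.
move=> p0.
have mulT (q : 'Z^I) (n : nat) : (forall j : U, 0 <= q (inl j)) -> Xpow_triangular q ->
    Xpow_triangular (q *+ n).
  move=> q0 qT; elim: n => [|n IH]; first exact: Xpow_triangular0.
  by rewrite mulrS; exact: Xpow_triangularD.
pose P (q : 'Z^I) := (forall j : U, 0 <= q (inl j)) /\ Xpow_triangular q.
suff: P p by case.
rewrite [p]fvec_expand.
apply: big_ind => [|q r [q0 qT] [r0 rT]|i _].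
- by split=> [j|]; [rewrite ffunE|exact: Xpow_triangular0].
- split=> [j|]; first by rewrite ffunE addr_ge0.
  exact: Xpow_triangularD.
split=> [j|].
  rewrite ffunMzE ffunE; case: eqP => [->|_]; last by rewrite mul0rz.
  by rewrite intz.
case: i => [k|k].
  rewrite -[p _]gez0_abs //; apply: mulT; last exact: Xpow_triangular_fvec.
  by move=> j; rewrite ffunE ler0n.
case: (p (inr k)) => n.
  by apply: mulT; [move=> j; rewrite ffunE|exact: Xpow_triangular_fvec].
rewrite NegzE mulrNz -mulNrz; apply: mulT; last exact: Xpow_triangular_fvecN.
by move=> j; rewrite !ffunE oppr0.
Qed.

End Triangular.

End Families.

(** * Linear maps between exponent lattices *)

Section IntegerLinear.
Context (T T' : finType).
Implicit Types (e : T -> 'Z^T') (m : 'Z^T).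

Definition zlin e m : 'Z^T' := \sum_i e i *~ m i.

Lemma zlin_is_zmod e : {morph zlin e : m n / m - n}.
Proof.
move=> m n; rewrite /zlin -sumrB; apply: eq_bigr => i _.
by rewrite !ffunE mulrzBr.
Qed.

HB.instance Definition _ e := Algebra.isZmodMorphism.Build _ _ (zlin e) (zlin_is_zmod e).

Lemma zlin_fvec e i : zlin e (fvec i) = e i.
Proof.
rewrite /zlin (bigD1 i) //= big1 ?addr0 => [|j /negPf ij].
  by rewrite ffunE eqxx.
by rewrite ffunE eq_sym ij mulr0z.
Qed.

Lemma eq_additive_fvec (f g : {additive 'Z^T -> 'Z^T'}) :
  (forall i, f (fvec i) = g (fvec i)) -> f =1 g.
Proof.
move=> fg m; rewrite [m]fvec_expand !raddf_sum; apply: eq_bigr => i _.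
by rewrite !raddfMz fg.
Qed.

End IntegerLinear.

Lemma zlin_id (T : finType) (m : 'Z^T) : zlin (@fvec T) m = m.
Proof. by rewrite [RHS]fvec_expand. Qed.

Lemma bilin_zlin (T T' : finType) (Lam' : T' -> T' -> int) (e : T -> 'Z^T') (m n : 'Z^T) :
  (forall i j, Lam' i j = - Lam' j i) ->
  bilin Lam' (zlin e m) (zlin e n) =
  \sum_i \sum_j m i * n j * bilin Lam' (e i) (e j).
Proof.
move=> sk; rewrite bilin_suml; apply: eq_bigr => i _.
rewrite (bilin_skew sk) bilin_suml -sumrN big_distrr; apply: eq_bigr => j _ /=.
by rewrite (bilin_skew sk (e i)); ring.
Qed.

(** * Morphisms sending variables to monomials *)

Section SkewTorus.
Context (T : finType) (Lam : T -> T -> int).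
Hypothesis Lam_skew : forall i j, Lam i j = - Lam j i.
Implicit Types m n : 'Z^T.

Lemma XpowC m n :
  Xpow m * Xpow n = vpow (2 * bilin Lam m n) *: (Xpow n * Xpow m) :> qtorus Lam.
Proof.
rewrite [LHS]XpowM [in RHS]XpowM scalerA -vpowD addrC (bilin_skew Lam_skew n).
by have -> (x : int) : 2 * x + - x = x by ring.
Qed.

Lemma Xpow_mulVr m : Xpow m * Xpow (- m) = 1 :> qtorus Lam.
Proof.
rewrite XpowM bilinNr subrr.
suff -> : bilin Lam m m = 0 by rewrite oppr0 vpow0 scale1r.
by have := bilin_skew Lam_skew m m; lia.
Qed.

End SkewTorus.

Section MonomialMorphisms.
Context (T T' : finType) (Lam : T -> T -> int) (Lam' : T' -> T' -> int).
Hypothesis Lam_skew : forall i j, Lam i j = - Lam j i.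
Hypothesis Lam'_skew : forall i j, Lam' i j = - Lam' j i.
Context (E : algType kk) (f : {lrmorphism qtorus Lam -> E})
  (f' : {lrmorphism qtorus Lam' -> E}) (f'_inj : injective f').
Context (D : pred T) (e : T -> 'Z^T').
Hypothesis fX : forall i, D i -> f (Xpow (fvec i)) = f' (Xpow (e i)).

(** Two variables commute up to [v] to twice their pairing. [f] preserves this relation and [f'] is
    injective, so the pairing of the image exponents can be read off. *)
Lemma morph_Xpow_bilin i j : D i -> D j -> bilin Lam' (e i) (e j) = Lam i j.
Proof.
move=> Di Dj.
have comm : Xpow (e i) * Xpow (e j) =
    vpow (2 * Lam i j) *: (Xpow (e j) * Xpow (e i)) :> qtorus Lam'.
  apply: f'_inj; rewrite linearZ !rmorphM /= -!fX // -!rmorphM -linearZ /=.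
  by rewrite [in LHS](XpowC Lam_skew) bilinff.
have /malgP/(_ (e i + e j)) := comm.
rewrite mcoeff_XpowM mcoeffZ mcoeff_XpowM !mcoeff_Xpow.
rewrite [e i + e j - e i]addrAC subrr add0r addrK !eqxx !mulr1 -vpowD.
by move=> /vpow_inj; rewrite (bilin_skew Lam'_skew (e j)); lia.
Qed.

(** [D] selects the variables with monomial image: a mutation map is monomial on all variables but
    the mutated one. *)
Let supported (m : 'Z^T) := forall i, ~~ D i -> m i = 0.

Lemma bilin_supported m n : supported m -> supported n ->
  bilin Lam' (zlin e m) (zlin e n) = bilin Lam m n.
Proof.
move=> Dm Dn; rewrite bilin_zlin //; apply: eq_bigr => i _; apply: eq_bigr => j _.
case: (boolP (D i)) => Di; last by rewrite Dm // !mul0r.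
case: (boolP (D j)) => Dj; last by rewrite Dn // !(mulr0, mul0r).
by rewrite morph_Xpow_bilin.
Qed.

(** The good exponents form a subgroup: sums because the pairing is preserved, opposites because
    inverses are unique. *)
Lemma morph_Xpow m : supported m -> f (Xpow m) = f' (Xpow (zlin e m)).
Proof.
pose P m := supported m /\ f (Xpow m) = f' (Xpow (zlin e m)).
have PD p q : P p -> P q -> P (p + q).
  move=> [Dp Ep] [Dq Eq]; split=> [i Di|]; first by rewrite ffunE Dp ?Dq.
  rewrite XpowE raddfD XpowE !linearZ !rmorphM /= Ep Eq; congr (_ *: _).
  by rewrite bilin_supported.
have PN p : P p -> P (- p).
  move=> [Dp Ep]; split=> [i Di|]; first by rewrite ffunE Dp ?oppr0.
  have inv' : f' (Xpow (zlin e p)) * f' (Xpow (- zlin e p)) = 1.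
    by rewrite -rmorphM (Xpow_mulVr _) // rmorph1.
  have inv : f (Xpow (- p)) * f (Xpow p) = 1.
    by rewrite -{2}[p]opprK -rmorphM (Xpow_mulVr _) // rmorph1.
  by rewrite raddfN -[LHS]mulr1 -inv' mulrA -Ep inv mul1r.
have P0 : P 0 by split=> [i _|]; rewrite ?ffunE // raddf0 !Xpow0 !rmorph1.
move=> Dm; suff [] : P m by [].
rewrite [m]fvec_expand; apply: big_ind => // i _.
case: (boolP (D i)) => Di; last by rewrite Dm.
apply: (@mulrz_closed _ P) => //; split=> [j|]; last by rewrite fX // zlin_fvec.
by rewrite ffunE; case: eqP => // <-; rewrite Di.
Qed.

End MonomialMorphisms.

(** * Mutation on exponents and on monomials *)

Section MutationLattice.
Context (U Fr : finType).
Notation I := (U + Fr)%type.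
Implicit Types (t : qseed U Fr) (k : U) (m p : 'Z^I).

Lemma bt_diag t k : bt t (inl k) k = 0.
Proof.
have := dd_bt_skew t k k; have := dd_gt0 t k => d0 H.
have : dd t k * bt t (inl k) k = 0 by lra.
by move/eqP; rewrite mulf_eq0 (gt_eqF d0) => /eqP.
Qed.

Lemma mut_fk t k (l : I) :
  mut_f t k (inl k) l = if l == inl k then -1 else posp (- bt t l k).
Proof.
rewrite /mut_f eqxx !ffunE sum_ffunE (bigD1 l) //= ffunMzE ffunE eqxx big1.
  rewrite addr0 eq_sym intz; case: eqP => [->|_]; last by rewrite oppr0 add0r.
  by rewrite bt_diag oppr0 /posp maxxx addr0.
by move=> l' /negPf nl; rewrite ffunMzE ffunE nl mul0rz.
Qed.

Lemma mut_f_neq t k (i : I) : i != inl k -> mut_f t k i = fvec i.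
Proof. by rewrite /mut_f => /negPf ->. Qed.

(** [zlin (mut_f t k)] is the change of coordinates from the exponents of [mutate k t] to those of
    [t]. *)
Lemma zlin_mut_f t k m (l : I) : zlin (mut_f t k) m l =
  if l == inl k then - m (inl k) else m l + m (inl k) * posp (- bt t l k).
Proof.
rewrite /zlin sum_ffunE (bigD1 (inl k)) //= ffunMzE mut_fk -mulrzr intz.
case: (eqVneq l (inl k)) => [->|nl].
  rewrite big1 ?addr0 => [|i ni]; first by rewrite mulN1r.
  by rewrite ffunMzE mut_f_neq // ffunE (negPf ni) mul0rz.
rewrite (bigD1 l) //= ffunMzE mut_f_neq // ffunE eqxx intz big1 => [|i /andP[ni il]].
  by rewrite addr0 addrC mulrC.
by rewrite ffunMzE mut_f_neq // ffunE (negPf il) mul0rz.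
Qed.

Lemma zlin_mut_f0 t k m : m (inl k) = 0 -> zlin (mut_f t k) m = m.
Proof.
move=> m0; apply/ffunP => l; rewrite zlin_mut_f m0 mul0r addr0 oppr0.
by case: eqP => [->|].
Qed.

(** The coordinate at [k] changes sign, so it vanishes on the kernel, where the map is then the
    identity. *)
Lemma zlin_mut_f_inj t k : injective (zlin (mut_f t k)).
Proof.
move=> m m' E; apply/eqP; rewrite -subr_eq0; apply/eqP.
have : zlin (mut_f t k) (m - m') = 0 by rewrite raddfB /= E subrr.
move: (m - m') => {E} {}m E.
have m0 : m (inl k) = 0.
  by have /ffunP/(_ (inl k)) := E; rewrite zlin_mut_f eqxx ffunE; lra.
by rewrite -E zlin_mut_f0.
Qed.

(** Seen in [t], the new columns combine old ones with coefficients from the unfrozen part of the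
    matrix; hence similar seeds mutate alike. *)
Lemma zlin_mut_btv t k j : zlin (mut_f t k) (btv (mutate k t) (fvec j)) =
  if j == k then - btv t (fvec k)
  else btv t (fvec j) + btv t (fvec k) *~ posp (bt t (inl k) j).
Proof.
rewrite !btv_fvec; apply/ffunP => l; rewrite zlin_mut_f !ffunE /= /mut_bt eqxx /=.
case: (eqVneq j k) => [->|njk].
  by rewrite !ffunE bt_diag orbT; case: eqP => [->|_]; rewrite ?bt_diag; ring.
rewrite !ffunE ffunMzE ffunE -mulrzr intz orbF.
by case: eqP => [->|_]; rewrite ?bt_diag; ring.
Qed.

End MutationLattice.

Section MutationMap.
Context (U Fr : finType) (F : skew_fields U Fr).
Notation I := (U + Fr)%type.
Local Notation iota t := (fsf_emb (F t)).
Context (t : qseed U Fr) (k : U) (mi : mutation_iso F t k).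
Implicit Types (m p : 'Z^I).

Lemma mutation_Xpow p : p (inl k) = 0 ->
  mi (iota (mutate k t) (Xpow p)) = iota t (Xpow p).
Proof.
move=> p0.
have H (i : I) : i != inl k ->
    (mi \o iota (mutate k t)) (Xpow (fvec i)) = iota t (Xpow (fvec i)).
  exact: mi_X.
have := morph_Xpow (@lam_skew _ _ (mutate k t)) (@lam_skew _ _ t) (@fsf_inj _ _ (F t)) H.
by rewrite /= => ->; [rewrite zlin_id|move=> i; rewrite negbK => /eqP ->].
Qed.

(** As [[b]_+ - [-b]_+ = b], the two exchange monomials differ by the column of [k]. *)
Lemma mutation_Xpow_fvec0 :
  mi (iota (mutate k t) (Xpow (fvec (inl k)))) =
  iota t (Xpow (mut_f t k (inl k)) + Xpow (mut_f t k (inl k) + btv t (fvec k))).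
Proof.
set a := mut_f t k (inl k).
have aE : - fvec (inl k) + \sum_j fvec j *~ posp (- bt t j k) = a.
  by rewrite /a /mut_f eqxx.
have abE : - fvec (inl k) + \sum_j fvec j *~ posp (bt t j k) = a + btv t (fvec k).
  rewrite -aE -addrA; congr (_ + _).
  rewrite [btv _ _]fvec_expand -big_split /=; apply: eq_bigr => j _.
  rewrite btv_fvec ffunE -mulrzDr; congr (_ *~ _).
  by rewrite /posp; case: (lerP (bt t j k) 0); case: (lerP (- bt t j k) 0); lra.
by rewrite -abE -aE; exact: mi_Xk.
Qed.

(** As [p] vanishes at [k], it pairs to zero with the column of [k]; both exchange monomials get the
    same power of [v], which then cancels. *)
Lemma mutation_Xpow_fvec p : p (inl k) = 0 ->
  mi (iota (mutate k t) (Xpow (p + fvec (inl k)))) =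
  iota t (Xpow (p + mut_f t k (inl k)) +
          Xpow (p + mut_f t k (inl k) + btv t (fvec k))).
Proof.
move=> p0; set a := mut_f t k (inl k).
have lamE : bilin (lam (mutate k t)) p (fvec (inl k)) = bilin (lam t) p a.
  rewrite -[in RHS](zlin_mut_f0 t p0) /a -(zlin_fvec (mut_f t k)) bilin_zlin; first by [].
  exact: (@lam_skew _ _ t).
have lam0 : bilin (lam t) p (a + btv t (fvec k)) = bilin (lam t) p a.
  rewrite bilinDr bilin_btvr big1 ?oppr0 ?addr0 // => j _; rewrite ffunE.
  by case: eqP => [<-|_]; rewrite ?p0 ?mulr0 // mul0r.
rewrite XpowE !linearZ !rmorphM /= mutation_Xpow //.
rewrite mutation_Xpow_fvec0 -rmorphM -linearZ; congr (iota t _).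
by rewrite mulrDr !XpowM lam0 -scalerDr scalerA lamE vpowVr scale1r addrA.
Qed.

End MutationMap.

(** * Similar seeds under mutation *)

Section SeedSimilarity.
Context (U Fr : finType) (F : skew_fields U Fr)
  (mu : forall t k, mutation_iso F t k).
Notation I := (U + Fr)%type.
Local Notation iota t := (fsf_emb (F t)).
Implicit Types (t : qseed U Fr) (k : U) (m p : 'Z^I) (psi : I -> 'Z^I).
Context (sigma : {perm U}).

(** The trace of a variation map on exponents, [psi i] being the image of the basis vector at [i];
    frozen parts of the images are constrained only through the columns. *)
Definition lattice_similarity t t' psi : Prop :=
  [/\ Defs.similar sigma t t',
      forall k j, psi (inl k) (inl j) = (j == sigma k)%:R,
      forall r j, psi (inr r) (inl j) = 0
    & forall k, zlin psi (btv t (fvec k)) = btv t' (fvec (sigma k))].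

Lemma lattice_similarity_inl t t' psi m k : lattice_similarity t t' psi ->
  zlin psi m (inl (sigma k)) = m (inl k).
Proof.
move=> [_ psiU psiF _]; rewrite /zlin sum_ffunE (bigD1 (inl k)) //= ffunMzE psiU eqxx.
rewrite big1 ?intz ?addr0 // => -[j|j] nj; rewrite ffunMzE ?psiF ?mul0rz //.
have /negPf njk : k != j by apply: contraNneq nj => ->.
by rewrite psiU (inj_eq perm_inj) njk mul0rz.
Qed.

Lemma preceq_similarity t t' psi m p : lattice_similarity t t' psi ->
  preceq t m p -> preceq t' (zlin psi m) (zlin psi p).
Proof.
move=> [_ _ _ psiB] [n n0 ->]; rewrite raddfD /=.
exists [ffun j => n ((sigma^-1)%g j)]; first by move=> j; rewrite ffunE.
congr (_ + _); rewrite btv_expand raddf_sum [RHS]btv_expand /=.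
rewrite [RHS](reindex_inj (@perm_inj _ sigma)); apply: eq_bigr => k _ /=.
by rewrite raddfMz /= psiB; congr (_ *~ _); rewrite ffunE permK.
Qed.

(** The value at [k] is forced by [zlin_mutate_psi]: the coordinate changes of the two mutations
    must intertwine the old and the new map. The correction is frozen, hence fixed by these
    changes. *)
Definition mutate_psi t t' psi k (i : I) : 'Z^I :=
  if i == inl k then fvec (inl (sigma k)) +
    (zlin psi (mut_f t k (inl k)) - mut_f t' (sigma k) (inl (sigma k)))
  else psi i.

Section Step.
Context (t t' : qseed U Fr) (psi : I -> 'Z^I) (k : U).
Hypothesis sim : lattice_similarity t t' psi.
Local Notation psi1 := (mutate_psi t t' psi k).
Local Notation a := (mut_f t k (inl k)).
Local Notation a' := (mut_f t' (sigma k) (inl (sigma k))).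

Lemma mut_f_similarity (j : U) : (zlin psi a - a') (inl j) = 0.
Proof.
have [[btE _] _ _ _] := sim.
rewrite !ffunE -[j](permKV sigma) (lattice_similarity_inl _ _ sim) !mut_fk btE.
by rewrite !(inj_eq inl_inj) (inj_eq perm_inj) subrr.
Qed.

Lemma psi_inl_sigma (i : I) : i != inl k -> psi i (inl (sigma k)) = 0.
Proof.
have [_ psiU psiF _] := sim.
case: i => [j|r] ni; last exact: psiF.
have /negPf njk : k != j by apply: contraNneq ni => ->.
by rewrite psiU (inj_eq perm_inj) njk.
Qed.

Lemma zlin_mutate_psi m :
  zlin (mut_f t' (sigma k)) (zlin psi1 m) = zlin psi (zlin (mut_f t k) m).
Proof.
apply: (@eq_additive_fvec _ _ (zlin (mut_f t' (sigma k)) \o zlin psi1)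
  (zlin psi \o zlin (mut_f t k))) => i /=.
rewrite !zlin_fvec /mutate_psi; case: (eqVneq i (inl k)) => [->|ni].
  rewrite raddfD /= zlin_fvec zlin_mut_f0; last exact: mut_f_similarity.
  by rewrite addrC subrK.
by rewrite mut_f_neq // zlin_fvec zlin_mut_f0 // psi_inl_sigma.
Qed.

Lemma similar_mutate : Defs.similar sigma (mutate k t) (mutate (sigma k) t').
Proof.
have [[btE ddE] _ _ _] := sim; split=> // i j.
by rewrite /= /mut_bt !(inj_eq inl_inj) !(inj_eq perm_inj) !btE.
Qed.

(** Columns are compared after the injective change of coordinates at [sigma k], where both sides
    follow the same mutation rule. *)
Lemma lattice_similarity_mutate :
  lattice_similarity (mutate k t) (mutate (sigma k) t') psi1.
Proof.
have [[btE ddE] psiU psiF psiB] := sim; split; first exact: similar_mutate.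
- move=> j l; rewrite /mutate_psi; case: eqP => [[->]|_]; last exact: psiU.
  by rewrite ffunE mut_f_similarity addr0 ffunE (inj_eq inl_inj) eq_sym.
- by move=> r j; rewrite /mutate_psi psiF.
move=> j; apply: (@zlin_mut_f_inj _ _ t' (sigma k)).
rewrite zlin_mutate_psi !zlin_mut_btv (inj_eq perm_inj) btE.
case: eqP => _; first by rewrite raddfN /= psiB.
by rewrite raddfD raddfMz /= !psiB.
Qed.

Lemma mutation_step (E : algType kk) (f : {lrmorphism F t -> E})
    (f' : {lrmorphism F t' -> E}) : injective f' ->
  (forall m, f (iota t (Xpow m)) = f' (iota t' (Xpow (zlin psi m)))) ->
  forall m, f (mu t k (iota (mutate k t) (Xpow m))) =
    f' (mu t' (sigma k) (iota (mutate (sigma k) t') (Xpow (zlin psi1 m)))).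
Proof.
move=> f'_inj fX m; have [_ _ _ psiB] := sim.
have mi_inj s l : injective (mu s l) by exact/bij_inj/mi_bij.
pose g := f \o mu t k \o iota (mutate k t).
pose g' := f' \o mu t' (sigma k) \o iota (mutate (sigma k) t').
have g'_inj : injective g' by move=> x y /f'_inj/mi_inj/fsf_inj.
suff gX i : xpredT i -> g (Xpow (fvec i)) = g' (Xpow (psi1 i)).
  exact: (morph_Xpow (@lam_skew _ _ _) (@lam_skew _ _ _) g'_inj gX).
move=> _; rewrite /g /g' /= /mutate_psi; case: (eqVneq i (inl k)) => [->|ni].
  have fXX p q : f (iota t (Xpow p + Xpow q)) =
      f' (iota t' (Xpow (zlin psi p) + Xpow (zlin psi q))).
    by rewrite [in LHS]raddfD [in LHS]raddfD [in RHS]raddfD [in RHS]raddfD /= !fX.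
  have R : mu t' (sigma k) (iota (mutate (sigma k) t')
        (Xpow (fvec (inl (sigma k)) + (zlin psi a - a')))) =
      iota t' (Xpow (zlin psi a) + Xpow (zlin psi (a + btv t (fvec k)))).
    rewrite (addrC (fvec _)) (mutation_Xpow_fvec _ (mut_f_similarity _)) subrK.
    by rewrite (raddfD (zlin psi)) /= psiB.
  by rewrite R; exact: etrans (congr1 f (mutation_Xpow_fvec0 (mu t k))) (fXX _ _).
have i0 : fvec i (inl k) = 0 by rewrite ffunE (negPf ni).
have fXi : f (iota t (Xpow (fvec i))) = f' (iota t' (Xpow (psi i))).
  by rewrite fX zlin_fvec.
rewrite (mutation_Xpow (mu t' (sigma k)) (psi_inl_sigma ni)).
exact: etrans (congr1 f (mutation_Xpow (mu t k) i0)) fXi.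
Qed.

End Step.

End SeedSimilarity.

(** * Mutation sequences and variation maps *)

Section Transport.
Context (U Fr : finType) (F : skew_fields U Fr)
  (mu : forall t k, mutation_iso F t k).
Notation I := (U + Fr)%type.
Local Notation iota t := (fsf_emb (F t)).
Implicit Types (t : qseed U Fr) (k : U) (m p : 'Z^I) (psi : I -> 'Z^I).

(** [mustar] is a bare recursive function; its morphism structure is recovered here. *)
Lemma mustar_lrmorphism ks t :
  exists2 g : {lrmorphism F (mutates ks t) -> F t}, g =1 mustar mu ks t & bijective g.
Proof.
elim: ks => [|k ks [g gE g_bij]] /=.
  by exists idfun => //; exists idfun.
exists (g \o mu (mutates ks t) k) => [x /=|]; first exact: gE.
by apply: bij_comp => //; exact: mi_bij.
Qed.

Lemma mustar_bij ks t : bijective (mustar mu ks t).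
Proof. by have [g gE g_bij] := mustar_lrmorphism ks t; exact: eq_bij g_bij _ gE. Qed.

(** Iteration of [mutation_step], with [f] and [f'] composed with the maps [mustar] of the shorter
    sequences. *)
Lemma mutations_transport (sigma : {perm U}) ks t t' psi (E : algType kk)
    (f : {lrmorphism F t -> E}) (f' : {lrmorphism F t' -> E}) :
  lattice_similarity sigma t t' psi -> injective f' ->
  (forall m, f (iota t (Xpow m)) = f' (iota t' (Xpow (zlin psi m)))) ->
  exists2 psi1, lattice_similarity sigma (mutates ks t) (mutates (map sigma ks) t') psi1 &
    forall m, f (mustar mu ks t (iota (mutates ks t) (Xpow m))) =
      f' (mustar mu (map sigma ks) t'
        (iota (mutates (map sigma ks) t') (Xpow (zlin psi1 m)))).
Proof.
move=> sim f'_inj fX; elim: ks => [|k ks [psi1 sim1 fX1]] /=; first by exists psi.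
exists (mutate_psi sigma (mutates ks t) (mutates (map sigma ks) t') psi1 k).
  exact: lattice_similarity_mutate.
have [g gE g_bij] := mustar_lrmorphism ks t.
have [g' g'E g'_bij] := mustar_lrmorphism (map sigma ks) t'.
have fg'_inj : injective (f' \o g') by apply: inj_comp => //; exact: bij_inj.
move=> m; rewrite -gE -g'E.
apply: (mutation_step mu k sim1 (f := f \o g) fg'_inj) => {}m /=.
by rewrite gE g'E fX1.
Qed.

Lemma frozen_expE m : (forall j : U, m (inl j) = 0) ->
  frozen_exp [ffun j => m (inr j)] = m.
Proof. by move=> m0; apply/ffunP => -[j|j]; rewrite !ffunE. Qed.

Lemma variation_mapP (sigma : {perm U}) t t' (var : {lrmorphism F t -> F t'}) :
  Defs.similar sigma t t' -> variation_map sigma var ->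
  exists psi, [/\ lattice_similarity sigma t t' psi,
    forall m, var (iota t (Xpow m)) = iota t' (Xpow (zlin psi m)),
    injective (zlin psi) & forall y, exists x, zlin psi x = y].
Proof.
move=> sim [var_bij /choice[u varX] varY varP].
have frozenX (v : 'Z^Fr) : exists w : 'Z^Fr,
    iota t' (Xpow (frozen_exp w)) = var (iota t (Xpow (frozen_exp v))).
  have : frozen_factors (t:=t') (var (iota t (Xpow (frozen_exp v)))).
    by rewrite -varP; exists (iota t (Xpow (frozen_exp v))) => //; exists v.
  by move=> [w _ wE]; exists w.
have {frozenX}/choice[w varR] : forall r : Fr, exists w : 'Z^Fr,
    iota t' (Xpow (frozen_exp w)) = var (iota t (Xpow (fvec (inr r)))).
  move=> r; have [w wE] := frozenX (fvec r); exists w; rewrite wE.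
  have -> // : frozen_exp (fvec r) = fvec (inr r) :> 'Z^I.
  by apply/ffunP => -[j|j]; rewrite !ffunE.
pose psi (i : I) : 'Z^I := match i with
  | inl k => frozen_exp (u k) + fvec (inl (sigma k))
  | inr r => frozen_exp (w r) end.
have var_inj : injective var by exact: bij_inj.
have varM m : var (iota t (Xpow m)) = iota t' (Xpow (zlin psi m)).
  apply: (@morph_Xpow _ _ (lam t) (lam t') (@lam_skew _ _ t) (@lam_skew _ _ t') _
    (var \o iota t) (iota t') (@fsf_inj _ _ (F t')) xpredT psi) => // -[k|r] _ /=.
    by rewrite -cmul_Xpow -varX.
  by rewrite varR.
have psi_inj : injective (zlin psi).
  move=> m n E; apply: (@Xpow_inj _ (lam t)); apply: (@fsf_inj _ _ (F t)).
  by apply: var_inj; rewrite !varM E.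
have lsim : lattice_similarity sigma t t' psi.
  split=> // [k j|r j|k]; first by rewrite !ffunE add0r (inj_eq inl_inj) eq_sym.
    by rewrite ffunE.
  (* The column condition is the rule for the [Y] variables, read on exponents. *)
  apply: (@Xpow_inj _ (lam t')); apply: (@fsf_inj _ _ (F t')).
  by rewrite -varM; exact: varY.
exists psi; split=> // y.
pose x := \sum_k fvec (inl k) *~ y (inl (sigma k)) : 'Z^I.
have xE k : x (inl k) = y (inl (sigma k)).
  rewrite sum_ffunE (bigD1 k) //= ffunMzE ffunE eqxx big1 ?addr0 ?intz //.
  by move=> j /negPf jk; rewrite ffunMzE ffunE (inj_eq inl_inj) jk mul0rz.
have y0 (j : U) : (y - zlin psi x) (inl j) = 0.
  rewrite !ffunE -[j](permKV sigma) (lattice_similarity_inl _ _ lsim) xE.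
  by rewrite subrr.
have : frozen_factors (t:=t') (iota t' (Xpow (y - zlin psi x))).
  by exists [ffun j => (y - zlin psi x) (inr j)] => //; rewrite frozen_expE.
rewrite -varP => -[_ [v _ <-]]; rewrite varM => /fsf_inj/Xpow_inj vE.
by exists (frozen_exp v + x); rewrite raddfD /= vE subrK.
Qed.

End Transport.

(** * Shifts by frozen exponents *)

Section FrozenShift.
Context (U Fr : finType) (t : qseed U Fr).
Notation I := (U + Fr)%type.
Context (b : 'Z^I -> LP t).
Hypothesis bT : triangular_family b.

Lemma triangular_family_frozen (q g x : 'Z^I) : (forall j : U, q (inl j) = 0) ->
  (b (q + g))@_x = (b g)@_(x - q).
Proof.
pose P (q : 'Z^I) := forall g x, (b (q + g))@_x = (b g)@_(x - q).
have PD p r : P p -> P r -> P (p + r).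
  by move=> Pp Pr h y; rewrite -addrA Pp Pr opprD addrA.
have PN p : P p -> P (- p).
  by move=> Pp h y; have := Pp (- p + h) (y + p); rewrite addrA subrr add0r addrK opprK.
have P0 : P 0 by move=> h y; rewrite add0r subr0.
move=> q0; suff: P q by exact.
rewrite [q]fvec_expand; apply: big_ind => // -[k|r] _; first by rewrite q0.
apply: (@mulrz_closed _ P) => // h y; rewrite -(cmul_frozen_fvec bT) mcoeff_cmul //.
Qed.

(** The hypothesis covers nonnegative exponents only; a frozen [q] compensates the negative frozen
    coordinates of [p] and is then shifted away. *)
Lemma triangular_family_Xpow :
  (forall m : 'Z^I, nonneg m -> exists g, b g = Xpow m) ->
  forall p : 'Z^I, (forall j : U, 0 <= p (inl j)) -> b p = Xpow p.
Proof.
move=> mono p p0; pose q : 'Z^I := frozen_exp [ffun r => `|p (inr r)|].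
have q0 (j : U) : q (inl j) = 0 by rewrite ffunE.
have [|g gE] := mono (q + p).
  case=> [k|r]; rewrite !ffunE ?add0r //.
  by have := ler_norm (- p (inr r)); rewrite normrN; lra.
have bl h : ltriang h (b h) by case: bT.
have qpg : q + p = g.
  by apply: ltriang_deg_inj (ltriang_Xpow t (q + p)) _; rewrite -gE.
apply/malgP => x; rewrite -[x](addrK q) -triangular_family_frozen // qpg gE.
by rewrite addrK !mcoeff_Xpow [x + q]addrC (inj_eq (addrI q)).
Qed.

End FrozenShift.

(** * Triangular bases and the degrees reached from the shifted seed *)

Section TriangularBasis.
Context (U Fr : finType) (F : skew_fields U Fr)
  (mu : forall t k, mutation_iso F t k).
Notation I := (U + Fr)%type.
Local Notation iota t := (fsf_emb (F t)).
Implicit Types (t : qseed U Fr) (k : U) (m p : 'Z^I) (psi : I -> 'Z^I).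

Lemma triangular_basis_family t (A L : set (F t)) : triangular_basis mu A L ->
  exists b : 'Z^I -> LP t, [/\ triangular_family b, L = range (iota t \o b),
    forall p, (forall j : U, 0 <= p (inl j)) -> L (iota t (Xpow p))
    & exists ks, is_shift mu t ks].
Proof.
move=> [b [[LE _] [b_bar [mono [ks shift _]] b_pt b_tri]]].
have b_lt g : ltriang g (b g) by exact: pointed_ltriang.
have bT : triangular_family b.
  split=> // i g; have [c [cP norm]] := b_tri i g.
  exists (\sum_(g' <- msupp c) c@_g' *: b g').
    by exists c; split=> // g' /cP; rewrite addrC.
  by rewrite (addrC (fvec i)); exact: normalization_ltriang (ltriang_Xpow t _) (b_lt g) norm.
exists b; split=> //; last by exists ks.
move=> p p0; rewrite LE; exists p => //=; congr (iota t _).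
apply: triangular_family_Xpow => // m m0.
have : L (iota t (Xpow m)) by apply: mono; exists m.
by rewrite LE => -[g _ /fsf_inj gE]; exists g.
Qed.

(** The variables of the shifted seed have unfrozen degrees [- fvec k]. Degrees add under products,
    and products of cluster monomials of one seed are again such up to a power of [v], so every
    [- n] is reached. *)
Lemma shift_degree t (b : 'Z^I -> LP t) ks : is_shift mu t ks ->
  (forall g, ltriang g (b g)) ->
  (forall p, (forall j : U, 0 <= p (inl j)) ->
    exists g, mustar mu ks t (iota (mutates ks t) (Xpow p)) = iota t (b g)) ->
  forall n : 'Z^U, nonneg n -> exists g p : 'Z^I,
    [/\ forall j : U, g (inl j) = - n j, forall j : U, 0 <= p (inl j)
      & mustar mu ks t (iota (mutates ks t) (Xpow p)) = iota t (b g)].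
Proof.
move=> [sg shift] b_lt mono n n0.
have [f fE _] := mustar_lrmorphism mu ks t.
pose P (n : 'Z^U) := exists g p : 'Z^I,
    [/\ forall j : U, g (inl j) = - n j, forall j : U, 0 <= p (inl j)
      & f (iota (mutates ks t) (Xpow p)) = iota t (b g)].
have {}mono p : (forall j : U, 0 <= p (inl j)) ->
    exists g, f (iota (mutates ks t) (Xpow p)) = iota t (b g).
  by move=> /mono; rewrite fE.
have P0 : P 0.
  exists 0, 0; split=> [j|j|]; rewrite ?ffunE ?oppr0 //.
  have [|g gE] := mono 0; first by move=> j; rewrite ffunE.
  suff g0 : g = 0 by rewrite gE g0.
  have : iota t (b g) = iota t (Xpow 0) by rewrite -gE !Xpow0 !rmorph1.
  by move=> /fsf_inj bE; apply: ltriang_deg_inj (ltriang_Xpow t 0); rewrite -bE.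
have PD n1 n2 : P n1 -> P n2 -> P (n1 + n2).
  move=> [g1 [p1 [g1E p10 E1]]] [g2 [p2 [g2E p20 E2]]].
  have p0 j : 0 <= (p1 + p2) (inl j) by rewrite ffunE addr_ge0.
  have [g gE] := mono _ p0.
  exists (g1 + g2), (p1 + p2); split=> // [j|].
    by rewrite !ffunE g1E g2E opprD.
  rewrite gE; congr (iota t (b _)).
  move: gE; rewrite XpowE !linearZ !rmorphM /= E1 E2 -rmorphM -linearZ => /fsf_inj gE.
  have [c1 cle] := mcoeffM_ltriang (b_lt g1) (b_lt g2).
  have [bg1 bgle] := b_lt g.
  (* Each of the two leading degrees lies in the support of the other expression. *)
  apply: preceq_antisym; [apply: cle|apply: bgle].
    have: (b g)@_g != 0 by rewrite bg1 oner_neq0.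
    by rewrite -gE mcoeffZ; apply: contraNneq => ->; rewrite mulr0.
  by rewrite -gE mcoeffZ c1 -vpowD vpow_neq0.
have Pf k : P (fvec k).
  have [g [Z [ZE /pointed_ltriang gZ gk]]] := shift k.
  exists g, (fvec (inl (sg k))); have p0 (j : U) : 0 <= (fvec (inl (sg k)) : 'Z^I) (inl j).
    by rewrite ffunE.
  have [h hE] := mono _ p0; split=> //; rewrite hE; congr (iota t (b _)).
  move: ZE; rewrite -fE /Xvar hE => /fsf_inj bZ.
  by apply: ltriang_deg_inj gZ; rewrite -bZ.
suff [g [p [? ? pE]]] : P n by exists g, p; split=> //; rewrite -fE.
rewrite [n]fvec_expand; apply: big_ind => // k _.
rewrite -[n k]gez0_abs //; elim: `|n k|%N => [|N IH]; first exact: P0.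
by rewrite -pmulrn mulrS; exact: PD.
Qed.

End TriangularBasis.

(** * Transport of the triangular basis along a variation map *)

Section BasisTransport.
Context (U Fr : finType) (F : skew_fields U Fr)
  (mu : forall t k, mutation_iso F t k).
Notation I := (U + Fr)%type.
Local Notation iota t := (fsf_emb (F t)).
Implicit Types (t : qseed U Fr) (k : U) (m p : 'Z^I) (psi : I -> 'Z^I).

Lemma monomial_push t t' (var : {lrmorphism F t -> F t'}) (h : 'Z^I -> 'Z^I) :
  injective h -> (forall m, var (iota t (Xpow m)) = iota t' (Xpow (h m))) ->
  forall Z : LP t, exists2 Z' : LP t', var (iota t Z) = iota t' Z' &
    forall y, Z'@_(h y) = Z@_y.
Proof.
move=> h_inj varX Z; exists (\sum_(x <- msupp Z) << Z@_x *g h x >>).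
  rewrite {1}(qtorus_expand Z) !raddf_sum; apply: eq_bigr => x _ /=.
  rewrite linearZ [LHS]linearZ /= varX -[LHS]linearZ; congr (iota t' _).
  by apply/malgP => y; rewrite mcoeffZ !mcoeffU mulrnAr mulr1.
by move=> y; exact: mcoeff_relabel.
Qed.

Section Variation.
Context (t t' : qseed U Fr) (A L : set (F t)) (A' L' : set (F t')).
Hypothesis LT :
  forall ks, triangular_basis mu (mustar mu ks t @^-1` A) (mustar mu ks t @^-1` L).
Hypothesis L'T :
  forall ks, triangular_basis mu (mustar mu ks t' @^-1` A') (mustar mu ks t' @^-1` L').
Context (sigma : {perm U}) (var : {lrmorphism F t -> F t'}).
Hypothesis var_sim : Defs.similar sigma t t'.
Hypothesis var_map : variation_map sigma var.

Lemma variation_map_basis : var @` L = L'.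
Proof.
have [psi [sim varX psi_inj psi_surj]] := variation_mapP var_sim var_map.
have /choice[chi chiK] := psi_surj.
have psiK : cancel (zlin psi) chi by move=> m; apply: psi_inj; rewrite chiK.
have [b [bT LE _ [ks shift]]] := triangular_basis_family (LT [::]).
have [b' [b'T L'E _ _]] := triangular_basis_family (L'T [::]).
have {LE} LE : L = range (iota t \o b) by exact: LE.
have {L'E} L'E : L' = range (iota t' \o b') by exact: L'E.
have b_lt g : ltriang g (b g) by case: bT.
have b'_lt g : ltriang g (b' g) by case: b'T.
have push := monomial_push psi_inj varX.
have psi_preceq x y : preceq t x y -> preceq t' (zlin psi x) (zlin psi y).
  exact: preceq_similarity sim.
have ltriang_push g (Z : LP t) (Z' : LP t') : ltriang g Z ->
    (forall y, Z'@_(zlin psi y) = Z@_y) -> ltriang (zlin psi g) Z'.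
  move=> [Z1 Zle] ZZ'; split=> [|x]; first by rewrite ZZ'.
  by rewrite -[x]chiK ZZ' => /Zle/psi_preceq.
(* [b1 y] is the image under [var] of the basis element with degree [chi y], written as a Laurent
   polynomial at [t']. *)
have /choice[b1 b1E] : forall y, exists Z' : LP t',
    var (iota t (b (chi y))) = iota t' Z' /\
    forall x, Z'@_(zlin psi x) = (b (chi y))@_x.
  by move=> y; have [Z' ? ?] := push (b (chi y)); exists Z'.
have b1_lt y : ltriang y (b1 y).
  by rewrite -{1}[y]chiK; apply: ltriang_push (b1E y).2; exact: b_lt.
have b1psi g : var (iota t (b g)) = iota t' (b1 (zlin psi g)).
  by rewrite -(b1E _).1 psiK.
have lower_push g W : lower b g W ->
    exists2 W1, lower b1 (zlin psi g) W1 & var (iota t W) = iota t' W1.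
  elim/lower_ind => [|a g' {}W [gg ne] ma [W1 W1l W1E]].
    by exists 0; [exact: lower0|rewrite !raddf0].
  exists (a *: b1 (zlin psi g') + W1).
    apply: lowerD => //; apply: lowerZ1 => //; split; first exact: psi_preceq.
    by move/psi_inj.
  by rewrite !raddfD /= W1E !linearZ /= b1psi.
(* With [idfun] for [f'] the common target is [F t']; [ks] leads to the shift of [t], [map sigma ks]
   to the matching seed. *)
have [psi' sim' varX'] :=
  mutations_transport mu ks (f := var) (f' := idfun) sim (@inj_id (F t')) varX.
have [_ [_ _ L_mono _]] := triangular_basis_family (LT ks).
have [_ [_ _ L'_mono _]] := triangular_basis_family (L'T (map sigma ks)).
have common n : nonneg n -> exists2 h : 'Z^I, (forall j, h (inl j) = - n j) &
    var (iota t (b h)) = iota t' (b' (zlin psi h)).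
  move=> n0; have [|h [p [hn p0 pE]]] := shift_degree shift b_lt _ n0.
    by move=> p /L_mono; rewrite /= LE => -[g _ gE]; exists g.
  exists h => //; rewrite -pE varX' /=.
  have : L' (mustar mu (map sigma ks) t'
      (iota (mutates (map sigma ks) t') (Xpow (zlin psi' p)))).
    by apply: L'_mono => j; rewrite -[j](permKV sigma) (lattice_similarity_inl _ _ sim').
  rewrite L'E => -[h' _ h'E]; rewrite -h'E /=; congr (iota t' (b' _)).
  (* The degree [h'] is found by comparing leading degrees with the image of [b h]. *)
  have := etrans h'E (esym (varX' p)); rewrite pE b1psi => /fsf_inj b'h'.
  by apply: ltriang_deg_inj (b1_lt _); rewrite -b'h'.
have b1b' : b1 =1 b'.
  apply: bar_invariant_unique => // [y|y|y]; last 1 first.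
  (* The absolute values in [n] clear the negative unfrozen coordinates, so [chi y = m + h] with [m]
     nonnegative there. *)
  - have [n n0 nE] : exists2 n : 'Z^U, nonneg n &
        forall j, 0 <= chi y (inl j) + n j.
      exists [ffun j => `|chi y (inl j)|] => j; rewrite ffunE //.
      by have := ler_norm (- chi y (inl j)); rewrite normrN; lra.
    have [h hn hE] := common n n0; set m := chi y - h.
    have m0 (j : U) : 0 <= m (inl j) by rewrite !ffunE hn opprK.
    have mh : m + h = chi y by rewrite subrK.
    clearbody m.
    have psim0 (j : U) : 0 <= zlin psi m (inl j).
      by rewrite -[j](permKV sigma) (lattice_similarity_inl _ _ sim).
    have [W Wl WE] := Xpow_triangular_nonneg bT m0 h.
    have [W' W'l W'E] := Xpow_triangular_nonneg b'T psim0 (zlin psi h).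
    have psimh : zlin psi m + zlin psi h = y.
      by rewrite -[RHS]chiK -mh raddfD.
    rewrite mh in Wl WE; rewrite psimh in W'l W'E.
    have [W1 W1l W1E] := lower_push _ _ Wl; rewrite chiK in W1l.
    exists W1, W'; split; [exact: W1l|exact: W'l|].
    have lamE : bilin (lam t') (zlin psi m) (zlin psi h) = bilin (lam t) m h.
      apply: (@bilin_supported _ _ (lam t) (lam t') (@lam_skew _ _ t) (@lam_skew _ _ t')
        _ (var \o iota t) (iota t') (@fsf_inj _ _ (F t')) xpredT psi) => // i _ /=.
      by rewrite varX zlin_fvec.
    apply: (scale_can_inj (vpowVr (bilin (lam t) m h))); apply: (@fsf_inj _ _ (F t')).
    have push_mul : var (iota t (Xpow m * b h)) =
        iota t' (Xpow (zlin psi m) * b' (zlin psi h)).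
      by rewrite !rmorphM /= varX hE.
    have push_tri c : var (iota t (c *: (b (chi y) + W))) = iota t' (c *: (b1 y + W1)).
      by rewrite !linearZ /= !raddfD /= W1E (b1E y).1.
    rewrite lamE in W'E.
    apply: etrans (esym (push_tri _)) (etrans _ (congr1 (iota t') W'E)).
    exact: etrans (congr1 (var \o iota t) (esym WE)) push_mul.
  (* Bar-invariance is a condition on coefficients, and [b1 y] has those of [b (chi y)]. *)
  - apply/bar_fixP => x; rewrite -[x]chiK (b1E y).2; move: (chi x).
    by apply: (bar_fixP _).1; case: bT.
  - by case: b'T.
have varb g : var (iota t (b g)) = iota t' (b' (zlin psi g)).
  by rewrite -b1b' -(b1E _).1 psiK.
rewrite LE L'E; apply/seteqP; split=> [_ [_ [g _ <-] <-]|_ [g _ <-]] /=.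
  by exists (zlin psi g) => //=; rewrite varb.
exists (iota t (b (chi g))); first by exists (chi g).
by rewrite varb chiK.
Qed.

End Variation.

(* The two seeds are equal only propositionally; quantifying over Q avoids casts
   between their skew fields. *)
Lemma mustar_cat ks w t (Q : forall s : qseed U Fr, (F s -> F t) -> Prop) :
  Q (mutates (ks ++ w) t) (mustar mu (ks ++ w) t) ->
  Q (mutates ks (mutates w t)) (mustar mu w t \o mustar mu ks (mutates w t)).
Proof.
elim: ks Q => [|k ks IH] Q //= H.
exact: (IH (fun s g => Q (mutate k s) (g \o mu s k))).
Qed.

End BasisTransport.

(* L is the realization at the initial seed t0; the one at  mutates w t0  is the
   inverse image under the bijection  mustar mu w t0. *)
Theorem proposition6p3p2 (U Fr : finType) (F : skew_fields U Fr)
    (mu : forall (t : qseed U Fr) (k : U), mutation_iso F t k)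
    (t0 : qseed U Fr)
    (reach : forall w : seq U, injective_reachable mu (mutates w t0))
    (A : set (F t0)) (A_sub : subalgebra A)
    (A_upper : A `<=` upper_cluster_algebra mu t0)
    (L : set (F t0)) (L_common : common_triangular_basis mu A L)
    (w : seq U) (tw : F (mutates w t0) -> F (mutates w t0))
    (Htw : twist_automorphism mu tw) :
  set_bij (mustar mu w t0 @^-1` L) (mustar mu w t0 @^-1` L) tw.
Proof.
have [LT _] := L_common; have [ks [sigma [var [sim var_map twE]]]] := Htw.
have triangular ks' : triangular_basis mu
    (mustar mu ks' (mutates w t0) @^-1` (mustar mu w t0 @^-1` A))
    (mustar mu ks' (mutates w t0) @^-1` (mustar mu w t0 @^-1` L)).
  exact: (@mustar_cat _ _ _ mu ks' w t0
    (fun s g => triangular_basis mu (g @^-1` A) (g @^-1` L))).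
(* From here on [mutates w t0] serves as the initial seed, with realizations [A1] and [L1]. *)
move: (mustar mu w t0 @^-1` A) (mustar mu w t0 @^-1` L) triangular => A1 L1 {}LT.
(* The seed through which [tw] passes is itself reached by mutations, so triangularity along all
   sequences holds from it too. *)
have LT' ks' := @mustar_cat _ _ _ mu ks' ks (mutates w t0)
    (fun s g => triangular_basis mu (g @^-1` A1) (g @^-1` L1)) (LT _).
have varL := variation_map_basis (A' := mustar mu ks (mutates w t0) @^-1` A1)
  (L' := mustar mu ks (mutates w t0) @^-1` L1) LT LT' sim var_map.
have [var_bij _ _ _] := var_map.
have [h hK Kh] := mustar_bij mu ks (mutates w t0).
split=> [x L1x|x y _ _|y L1y].
- by rewrite /= twE -[L1 _]/((mustar mu ks _ @^-1` L1) _) -varL; exists x.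
- by rewrite !twE => /(can_inj hK)/(bij_inj var_bij).
have : (mustar mu ks (mutates w t0) @^-1` L1) (h y) by rewrite /= Kh.
by rewrite -varL => -[x L1x xE]; exists x => //; rewrite twE xE Kh.
Qed.
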